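(* Let $R$ be a Dedekind domain with fraction field $K$ such that $2\leq |\operatorname{cl}(R)|<\infty$, let $n\geq 1$, and let $\omega$ be a symplectic form on $R^{2n}$, extended to $K^{2n}$. Then the symplectic Steinberg module $\operatorname{St}^\omega_n(K)=\tilde{H}_{n-1}(\operatorname{T}^\omega(K^{2n}))$ is not generated by integral apartment classes.
   Context: $\operatorname{cl}(R)$ is the class group of $R$: the set of isomorphism classes of rank-1 projective $R$-modules, an abelian group under tensor product. A symplectic form on $R^{2n}$ is a non-degenerate bilinear form $\omega$ with $\omega(x,x)=0$ for all $x$; it extends $K$-bilinearly to a symplectic form (also denoted $\omega$) on $K^{2n}=R^{2n}\otimes_R K$. A subspace $V\subseteq K^{2n}$ is isotropic if $\omega(x,y)=0$ for all $x,y\in V$. $\operatorname{T}^\omega(K^{2n})$ is the poset of nonzero isotropic subspaces of $K^{2n}$ ordered by inclusion, identified with its order complex, which is $(n-1)$-dimensional; $\operatorname{St}^\omega_n(K)$ is its reduced homology group in degree $n-1$. Let $[n]=\{1,\dots,n\}$, $[\pm n]=\{1,\dots,n,-n,\dots,-1\}$, and let $S^B_n$ be the group of signed permutations, i.e. permutations $\sigma$ of $[\pm n]$ with $\sigma(-i)=-\sigma(i)$, with multiplication being composition of functions; it is generated by $s_1,\dots,s_n$, where for $i<n$, $s_i$ swaps $i$ with $i+1$ (and $-i$ with $-(i+1)$) and fixes all other elements, and $s_n$ swaps $n$ with $-n$ and fixes all other elements. $\operatorname{len}(\sigma)$ is the word length of $\sigma$ with respect to $\{s_1,\dots,s_n\}$.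 A symplectic frame of $K^{2n}$ is a collection $\mathbf{L}=\{L_1,\dots,L_n,L_{-n},\dots,L_{-1}\}$ of 1-dimensional subspaces such that $L_i+L_j$ is isotropic if and only if $j\neq -i$. For $\sigma\in S^B_n$ and $1\le m\le n$ put $L_{\sigma([m])}=\bigoplus_{i\in\sigma([m])}L_i$ (an isotropic subspace), and let $\mathbf{L}_\sigma$ be the $(n-1)$-simplex $L_{\sigma([1])}\subset\cdots\subset L_{\sigma([n])}$ of $\operatorname{T}^\omega(K^{2n})$. The apartment class of $\mathbf{L}$ is $[\Sigma_{\mathbf{L}}]=\sum_{\sigma\in S^B_n}(-1)^{\operatorname{len}(\sigma)}\mathbf{L}_\sigma\in\operatorname{St}^\omega_n(K)$ (defined up to sign). The frame $\mathbf{L}$, and its apartment class, is called integral if $R^{2n}=(L_1\cap R^{2n})\oplus\cdots\oplus(L_n\cap R^{2n})\oplus(L_{-n}\cap R^{2n})\oplus\cdots\oplus(L_{-1}\cap R^{2n})$. *)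

(* Defs.v *)
From HB Require Import structures.
From mathcomp Require Import all_boot all_order all_fingroup all_algebra.
From mathcomp Require Import ring_quotient generic_quotient.
From mathcomp Require Import freeg.
From mathcomp Require Import zify.
From mathcomp Require Import boolp classical_sets cardinality.

Set Implicit Arguments.
Unset Strict Implicit.
Unset Printing Implicit Defensive.

Import Order.TTheory GRing.Theory.

Local Open Scope ring_scope.

Section Ideals.
Variable R : idomainType.

Definition is_ideal (I : set R) : Prop :=
  [/\ I 0, forall x y, I x -> I y -> I (x + y)
    & forall a x, I x -> I (a * x)].

Definition ideal_fg (I : set R) : Prop :=
  exists (k : nat) (g : 'I_k -> R),
    forall x, I x <-> exists a : 'I_k -> R, x = \sum_i a i * g i.

Definition is_prime_ideal (I : set R) : Prop :=
  [/\ is_ideal I, ~ I 1 & forall x y, I (x * y) -> I x \/ I y].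

Definition is_maximal_ideal (I : set R) : Prop :=
  [/\ is_ideal I, ~ I 1
    & forall J : set R, is_ideal J -> (I `<=` J)%classic -> ~ J 1 -> J = I].

Definition noetherian : Prop := forall I : set R, is_ideal I -> ideal_fg I.

Definition integrally_closed : Prop :=
  forall x : {fraction R},
    integralOver (@tofrac R : R -> {fraction R}) x -> exists r : R, x = tofrac r.

(* Fields are allowed, as is customary; their class group is trivial. *)
Definition dedekind_domain : Prop :=
  [/\ noetherian, integrally_closed
    & forall I : set R, is_prime_ideal I -> (exists2 x, I x & x != 0) ->
        is_maximal_ideal I].

End Ideals.

Section ClassGroup.
Variable R : idomainType.

Definition module_fg (M : lmodType R) : Prop :=
  exists (k : nat) (g : 'I_k -> M),
    forall x : M, exists a : 'I_k -> R, x = \sum_i a i *: g i.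

Definition projective (P : lmodType R) : Prop :=
  forall (A B : lmodType R) (f : {linear A -> B}) (g : {linear P -> B}),
    (forall b : B, exists a : A, f a = b) ->
    exists h : {linear P -> A}, forall x, f (h x) = g x.

Definition lin_indep (M : lmodType R) (k : nat) (v : 'I_k -> M) : Prop :=
  forall a : 'I_k -> R, \sum_i a i *: v i = 0 -> forall i, a i = 0.

(* The rank of a module over a domain is the maximal number of linearly
   independent elements, that is, the dimension of its tensor product with the
   fraction field. *)
Definition module_rank (M : lmodType R) (r : nat) : Prop :=
  (exists v : 'I_r -> M, lin_indep v) /\
  (forall k (v : 'I_k -> M), lin_indep v -> (k <= r)%N).

Definition module_iso (M N : lmodType R) : Prop :=
  exists f : {linear M -> N}, bijective f.

Definition rank1_projective (P : lmodType R) : Prop :=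
  [/\ module_fg P, projective P & module_rank P 1].

(* cl(R) has exactly h elements: P lists one representative of each
   isomorphism class.  Only the cardinality of cl(R) is used. *)
Definition class_number (h : nat) : Prop :=
  exists P : 'I_h -> lmodType R,
    [/\ forall i, rank1_projective (P i),
        forall i j, module_iso (P i) (P j) -> i = j
      & forall Q, rank1_projective Q -> exists i, module_iso (P i) Q].

End ClassGroup.

Section OrderComplex.
Variables (d : Order.disp_t) (P : porderType d).

(* The simplices with p vertices (of dimension p - 1); the empty simplex,
   p = 0, is included, which makes the chain complex the augmented one. *)
Definition simplex (p : nat) : Type :=
  {s : seq P | sorted <%O s && (size s == p)}.

HB.instance Definition _ p := Choice.on (simplex p).

Lemma face_subproof p (i : 'I_p) (s : simplex p) :
  let t := take i (val s) ++ drop i.+1 (val s) in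
  sorted <%O t && (size t == p.-1).
Proof.
case: s => s /= /andP[sS /eqP szs]; apply/andP; split.
  apply: (subseq_sorted lt_trans) sS.
  rewrite -[X in subseq _ X](cat_take_drop i).
  by rewrite cat_subseq // -add1n -drop_drop drop_subseq.
by rewrite size_cat size_takel ?size_drop ?szs; case: i => i /= hi; lia.
Qed.

Definition face p (i : 'I_p) (s : simplex p) : simplex p.-1 :=
  exist _ (take i (val s) ++ drop i.+1 (val s)) (face_subproof i s).

Definition chain (p : nat) := {freeg (simplex p)}.

Definition boundary (p : nat) : chain p -> chain p.-1 :=
  fglift (fun s => \sum_(i < p) (-1) ^+ i *: << face i s >>).

Lemma boundary_is_zmod_morphism p : zmod_morphism (@boundary p).
Proof. exact: lift_is_additive. Qed.

HB.instance Definition _ p := GRing.isZmodMorphism.Build (chain p) (chain p.-1)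
  (@boundary p) (@boundary_is_zmod_morphism p).

Definition is_cycle p : {pred chain p} := fun c => boundary c == 0.

Lemma is_cycle_zmod p : zmod_closed (@is_cycle p).
Proof.
split; first by apply/eqP; rewrite raddf0.
move=> x y /eqP hx /eqP hy; apply/eqP.
by rewrite raddfB /= hx hy subrr.
Qed.

HB.instance Definition _ p := GRing.isZmodClosed.Build (chain p)
  (@is_cycle p) (@is_cycle_zmod p).

Record cycles p := Cycle { cycle_val : chain p; _ : cycle_val \in @is_cycle p }.

HB.instance Definition _ p := [isSub for @cycle_val p].
HB.instance Definition _ p := [Choice of cycles p by <:].
HB.instance Definition _ p := [SubChoice_isSubZmodule of cycles p by <:].

Definition is_boundary p : {pred cycles p} :=
  fun z => `[< exists c : chain p.+1, boundary c = val z >].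

Lemma is_boundary_zmod p : zmod_closed (@is_boundary p).
Proof.
split; first by apply/asboolP; exists 0; rewrite raddf0.
move=> x y /asboolP[a ha] /asboolP[b hb]; apply/asboolP; exists (a - b).
by rewrite raddfB /= ha hb.
Qed.

HB.instance Definition _ p := GRing.isZmodClosed.Build (cycles p)
  (@is_boundary p) (@is_boundary_zmod p).

(* Reduced homology in degree p - 1, with integer coefficients. *)
Definition reduced_homology p : zmodType := {ideal_quot (@is_boundary p)}.

Definition homology_class p (z : cycles p) : reduced_homology p :=
  \pi_({ideal_quot (@is_boundary p)})%qT z.

End OrderComplex.

Definition generated_by (A : zmodType) (S : A -> Prop) : Prop :=
  forall x : A, exists (k : nat) (c : 'I_k -> int) (g : 'I_k -> A),
    (forall i, S (g i)) /\ x = \sum_i g i *~ c i.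

Fact isotropic_display : Order.disp_t. Proof. exact: (Order.Disp tt tt). Qed.

Section Isotropic.
Variables (K : fieldType) (m : nat) (G : 'M[K]_m).
Implicit Types U V W : {vspace 'rV[K]_m}.

Definition gram_form (x y : 'rV[K]_m) : K := (x *m G *m y^T) 0 0.

Definition isotropic V : Prop :=
  forall x y, x \in V -> y \in V -> gram_form x y = 0.

Definition isotropic_poset : Type :=
  {V : {vspace 'rV[K]_m} | (V != 0%VS) && `[< isotropic V >]}.

HB.instance Definition _ := Choice.on isotropic_poset.

Definition isotropic_le (V W : isotropic_poset) : bool := (val V <= val W)%VS.

Lemma isotropic_le_refl : reflexive isotropic_le.
Proof. by move=> V; exact: subvv. Qed.

Lemma isotropic_le_anti : antisymmetric isotropic_le.
Proof. by move=> V W h; apply/val_inj/eqP; rewrite eqEsubv. Qed.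

Lemma isotropic_le_trans : transitive isotropic_le.
Proof. by move=> V U W; exact: subv_trans. Qed.

HB.instance Definition _ := Order.Le_isPOrder.Build isotropic_display
  isotropic_poset isotropic_le_refl isotropic_le_anti isotropic_le_trans.

Lemma gram_form_sum (I J : finType) (P : pred I) (Q : pred J)
    (x : I -> 'rV[K]_m) (y : J -> 'rV[K]_m) :
  gram_form (\sum_(i | P i) x i) (\sum_(j | Q j) y j) =
  \sum_(i | P i) \sum_(j | Q j) gram_form (x i) (y j).
Proof.
rewrite /gram_form linear_sum /= !mulmx_suml summxE.
by apply: eq_bigr => i _; rewrite mulmx_sumr summxE.
Qed.

End Isotropic.

Section SignedPermutations.
Variable n : nat.

(* The element i + 1 of [n] is encoded as (i, false), and -(i + 1) as
   (i, true). *)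
Definition signed_index : finType := ('I_n * bool)%type.

Definition sneg (k : signed_index) : signed_index := (k.1, ~~ k.2).

Definition is_signed (s : {perm signed_index}) : bool :=
  [forall k, s (sneg k) == sneg (s k)].

Definition signed_perm : Type := {s : {perm signed_index} | is_signed s}.

HB.instance Definition _ := Finite.on signed_perm.

Definition sswap (i j : 'I_n) : {perm signed_index} :=
  (tperm (i, false) (j, false) * tperm (i, true) (j, true))%g.

Definition sflip (i : 'I_n) : {perm signed_index} :=
  tperm (i, false) (i, true).

Definition sgens : {set {perm signed_index}} :=
  [set s | [exists i : 'I_n, exists j : 'I_n,
              (j == i.+1 :> nat) && (s == sswap i j)]] :|:
  [set s | [exists i : 'I_n, (i.+1 == n) && (s == sflip i)]].

(* sgens ^+ k is the set of products of k elements of sgens.  The product of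
   permutations is composition in the opposite order, which is irrelevant here:
   reversing a word does not change its length. *)
Definition slength (s : {perm signed_index}) : nat :=
  match pselect (exists k, s \in (sgens ^+ k)%g) with
  | left h => ex_minn h
  | right _ => 0
  end.

Local Open Scope group_scope.

Lemma signedP (s : {perm signed_index}) :
  reflect (forall k, s (sneg k) = sneg (s k)) (is_signed s).
Proof. exact: 'forall_eqP. Qed.

Lemma snegK : involutive sneg.
Proof. by case=> k b; rewrite /sneg /= negbK. Qed.

Lemma is_signedM s t : is_signed s -> is_signed t -> is_signed (s * t).
Proof. by move=> /signedP hs /signedP ht; apply/signedP => k; rewrite !permM hs ht. Qed.

Lemma sswapE i j k b : sswap i j (k, b) = (tperm i j k, b).
Proof.
have eqc c l : tperm (i, c) (j, c) (l, c) = (tperm i j l, c).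
  case: tpermP => [[->]|[->]|/eqP h1 /eqP h2]; rewrite ?tpermL ?tpermR //.
  by rewrite tpermD // eq_sym; [move: h1|move: h2]; rewrite xpair_eqE eqxx andbT.
have nec c l : tperm (i, ~~ c) (j, ~~ c) (l, c) = (l, c).
  by rewrite tpermD // xpair_eqE; case: c; rewrite andbF.
by rewrite /sswap permM; case: b; rewrite ?(nec true) ?eqc ?(nec false).
Qed.

Lemma sflipE i k b : sflip i (k, b) = (k, b (+) (k == i)).
Proof.
rewrite /sflip; case: (eqVneq k i) => [->|ki].
  by case: b; rewrite ?tpermL ?tpermR.
by rewrite tpermD ?addbF // xpair_eqE eq_sym (negPf ki).
Qed.

Lemma sswap_signed i j : is_signed (sswap i j).
Proof. by apply/signedP => -[k b]; rewrite /sneg /= !sswapE. Qed.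

Lemma sflip_signed i : is_signed (sflip i).
Proof. by apply/signedP => -[k b]; rewrite /sneg /= !sflipE addNb. Qed.

Lemma sswapV i j : sswap i j * sswap i j = 1.
Proof. by apply/permP => -[k b]; rewrite permM !sswapE perm1 tpermK. Qed.

Lemma sswapC i j : sswap i j = sswap j i.
Proof. by apply/permP => -[k b]; rewrite !sswapE tpermC. Qed.

Lemma sswapJ i j s : is_signed s ->
  (sswap i j) ^ s = tperm (s (i, false)) (s (j, false)) *
                    tperm (sneg (s (i, false))) (sneg (s (j, false))).
Proof. by move=> /signedP hs; rewrite /sswap conjMg !tpermJ -!hs. Qed.

Lemma mem_sgens_swap (i j : 'I_n) : j = i.+1 :> nat -> sswap i j \in sgens.
Proof.
move=> h; rewrite !inE; apply/orP; left.
by apply/existsP; exists i; apply/existsP; exists j; rewrite h !eqxx.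
Qed.

Lemma mem_sgens_flip (i : 'I_n) : i.+1 = n -> sflip i \in sgens.
Proof.
by move=> h; rewrite !inE; apply/orP; right; apply/existsP; exists i; rewrite eqxx andbT; apply/eqP.
Qed.

Lemma sswap_gen (i j : 'I_n) : sswap i j \in <<sgens>>.
Proof.
wlog ij : i j / (i < j)%N => [hwlog|].
  case: (ltngtP i j) => [|ji|/val_inj <-]; first exact: hwlog.
    by rewrite sswapC; exact: hwlog.
  have -> : sswap i i = 1 by apply/permP => -[k b]; rewrite sswapE tperm1 !perm1.
  exact: group1.
case: j ij => j; elim: j => // j IH hj ij.
have hj' : (j < n)%N by exact: ltnW.
have adj : sswap (Ordinal hj') (Ordinal hj) \in <<sgens>>.
  by apply/mem_gen/mem_sgens_swap.
case: (eqVneq (nat_of_ord i) j) => [e|ne].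
  by have -> : i = Ordinal hj' by exact: val_inj.
have ij' : (i < j)%N by rewrite ltn_neqAle ne -ltnS.
have := groupJ (IH hj' ij') adj.
rewrite sswapJ ?sswap_signed // !sswapE /sneg /= tpermL tpermD //.
  by rewrite -val_eqE /= eq_sym.
by rewrite -val_eqE /= gtn_eqF // ltnS ltnW.
Qed.

Lemma sflip_gen (i : 'I_n) : sflip i \in <<sgens>>.
Proof.
have hn : (n.-1 < n)%N by rewrite prednK // (leq_ltn_trans _ (ltn_ord i)).
have hl : sflip (Ordinal hn) \in <<sgens>>.
  apply/mem_gen/mem_sgens_flip; rewrite /= prednK //.
  exact: leq_ltn_trans (ltn_ord i).
have := groupJ hl (sswap_gen (Ordinal hn) i).
by rewrite /sflip tpermJ !sswapE tpermL.
Qed.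

Lemma signed_gen (s : {perm signed_index}) : is_signed s -> s \in <<sgens>>.
Proof.
have [c] := ubnP #|[pred k | s k != k]|; elim: c s => // c IH s hc sg.
have sE := signedP _ sg.
case: (pickP [pred i | s (i, false) != (i, false)]) => [i /= hi|h]; last first.
  have -> : s = 1; last exact: group1.
  apply/permP => -[k b]; rewrite perm1; have /negbFE/eqP e := h k.
  by case: b => //; have := sE (k, false); rewrite /sneg /= e.
case e : (s (i, false)) => [j b].
pose g := (if b then sflip j else 1) * sswap j i.
have gE k c' : g (k, c') = (tperm j i k, c' (+) (b && (k == j))).
  rewrite /g permM; case: b {e g} => /=; first by rewrite sflipE sswapE.
  by rewrite perm1 sswapE addbF.
have gG : g \in <<sgens>>.
  by rewrite /g groupM ?sswap_gen //; case: ifP => _; rewrite ?group1 ?sflip_gen.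
have gS : is_signed g.
  by apply/signedP => -[k c']; rewrite /sneg /= !gE addNb.
rewrite -(groupMr _ gG); apply: IH; last exact: is_signedM.
rewrite -ltnS; apply: leq_trans hc; rewrite ltnS.
apply: proper_card; apply/properP; split.
  apply/fintype.subsetP => -[k c']; rewrite !inE permM; apply: contraNN => /eqP ek.
  have eqF k' : (k' == false) = ~~ k' by case: k'.
  have ski : k != i.
    apply: contraNN hi => /eqP ki; rewrite -ki; case: c' ek => [ek|-> //].
    have := sE (k, true); rewrite ek /sneg /= => ->; exact: eqxx.
  have skj : k != j.
    apply: contraNN ski => /eqP kj; apply/eqP.
    have ekb c2 : s (k, c2) = (k, c2).
      have := sE (k, c'); rewrite ek /sneg /=.
      by move: ek; case: c2; case: (c') => ? ?.
    have : s (i, false) = s (k, b) by rewrite e ekb kj.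
    by move/perm_inj => [->].
  by rewrite ek gE tpermD 1?eq_sym // (negPf skj) andbF addbF.
exists (i, false); first by rewrite inE.
by rewrite inE permM e gE tpermL eqxx andbT addbb eqxx.
Qed.

Lemma word_exists (s : {perm signed_index}) :
  is_signed s -> exists k, s \in sgens ^+ k.
Proof.
move=> /signed_gen/gen_prodgP[k [c hc ->]]; exists k.
elim: k c hc => [|k IH] c hc; first by rewrite big_ord0 expg0 inE.
rewrite big_ord_recl expgS; apply: mem_mulg; first exact: hc.
by apply: IH => i; exact: hc.
Qed.

Lemma slength_word s : is_signed s -> s \in sgens ^+ slength s.
Proof.
move=> hs; rewrite /slength; case: pselect => [h|/(_ (word_exists hs))//].
by case: ex_minnP.
Qed.

Definition sabs (s : {perm signed_index}) : {perm 'I_n} :=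
  insubd (1 : {perm 'I_n}) [ffun i => (s (i, false)).1].

Lemma sabsE s i : is_signed s -> sabs s i = (s (i, false)).1.
Proof.
move=> /signedP hs.
have inj : injective (fun i => (s (i, false)).1).
  move=> x y exy; case: (eqVneq (s (x, false)).2 (s (y, false)).2) => h.
    have : s (x, false) = s (y, false).
      by move: exy h; case: (s (x, false)) (s (y, false)) => ? ? [? ?] /= -> ->.
    by move/perm_inj => [].
  have : s (x, false) = s (sneg (y, false)).
    rewrite hs; move: exy h; case: (s (x, false)) (s (y, false)) => ? b1 [? b2] /= ->.
    by rewrite /sneg /=; case: b1 b2 => [] [].
  by move/perm_inj.
rewrite /sabs -pvalE insubdK; first by rewrite ffunE.
by apply/injectiveP => x y; rewrite !ffunE; exact: inj.
Qed.

Definition sparity (s : {perm signed_index}) : bool :=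
  odd_perm s (+) odd_perm (sabs s).

Lemma sparityM s t : is_signed s -> is_signed t ->
  sparity (s * t) = sparity s (+) sparity t.
Proof.
move=> hs ht; rewrite /sparity.
have -> : sabs (s * t) = sabs s * sabs t.
  apply/permP => i; rewrite permM !sabsE ?is_signedM // permM.
  case: (s (i, false)) => j [] //=.
  by have /signedP/(_ (j, false)) := ht; rewrite /sneg /= => ->.
by rewrite !odd_permM addbACA.
Qed.

Lemma sgens_signed s : s \in sgens -> is_signed s && sparity s.
Proof.
rewrite !inE => /orP[/existsP[i /existsP[j /andP[/eqP ji /eqP ->]]]|].
  have ij : i != j by rewrite -val_eqE /= ji ltn_eqF.
  rewrite sswap_signed /sparity /=.
  have -> : sabs (sswap i j) = tperm i j.
    by apply/permP => k; rewrite sabsE ?sswap_signed // sswapE.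
  by rewrite odd_permM !odd_tperm !xpair_eqE !eqxx !andbT ij.
case/existsP=> i /andP[_ /eqP ->]; rewrite sflip_signed /sparity /=.
have -> : sabs (sflip i) = 1.
  by apply/permP => k; rewrite sabsE ?sflip_signed // sflipE perm1.
by rewrite odd_perm1 odd_tperm xpair_eqE andbF.
Qed.

Lemma sparity_word s k : s \in sgens ^+ k -> is_signed s && (sparity s == odd k).
Proof.
elim: k s => [|k IH] s.
  rewrite expg0 inE => /eqP ->; apply/andP; split.
    by apply/signedP => i; rewrite !perm1.
  rewrite /sparity odd_perm1 /=.
  have -> : sabs 1 = 1; last by rewrite odd_perm1.
  apply/permP => i; rewrite sabsE ?perm1 //.
  by apply/signedP => j; rewrite !perm1.
rewrite expgS => /mulsgP[a b /sgens_signed/andP[ha pa] /IH/andP[hb /eqP pb] ->].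
by rewrite is_signedM // sparityM // pa pb /= eqxx.
Qed.

Lemma odd_slength s : is_signed s -> odd (slength s) = sparity s.
Proof. by move=> /slength_word/sparity_word/andP[_ /eqP]. Qed.

Lemma odd_slength_mul s t : s \in sgens -> is_signed t ->
  odd (slength (s * t)) = ~~ odd (slength t).
Proof.
move=> /sgens_signed/andP[hs ps] ht.
by rewrite !odd_slength ?is_signedM // sparityM // ps.
Qed.

(* The generator s_{i + 1}. *)
Definition sgen (i : 'I_n) : {perm signed_index} :=
  if insub i.+1 is Some j then sswap i j else sflip i.

Lemma mem_sgen i : sgen i \in sgens.
Proof.
rewrite /sgen; case: insubP => [j _ /= ji|]; first exact: mem_sgens_swap.
rewrite -leqNgt => h; apply: mem_sgens_flip.
by apply/eqP; rewrite eqn_leq h ltn_ord.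
Qed.

Lemma sgenV i : sgen i * sgen i = 1.
Proof.
rewrite /sgen; case: insubP => [j _ _|_]; first exact: sswapV.
exact: tperm2.
Qed.

Lemma sgenM_signed i (s : signed_perm) : is_signed (sgen i * val s).
Proof.
apply: is_signedM; last exact: valP.
by have /sgens_signed/andP[] := mem_sgen i.
Qed.

Definition sgen_mul i (s : signed_perm) : signed_perm :=
  exist _ (sgen i * val s) (sgenM_signed i s).

Lemma sgen_mulK i : involutive (sgen_mul i).
Proof. by move=> s; apply: val_inj; rewrite /= mulgA sgenV mul1g. Qed.

Close Scope group_scope.

End SignedPermutations.

Section Frames.
Variables (K : fieldType) (n m : nat) (G : 'M[K]_m).

Record frame := Frame {
  frame_line :> signed_index n -> {vspace 'rV[K]_m};
  frame_dim : forall k, \dim (frame_line k) = 1%N;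
  frame_isotropic : forall k l,
    isotropic G (frame_line k + frame_line l) <-> l <> sneg k }.

Variable L : frame.

(* L_{s([k])} *)
Definition frame_flag (s : {perm signed_index n}) (k : nat) :
    {vspace 'rV[K]_m} :=
  (\sum_(i < n | (i < k)%N) L (s (i, false)))%VS.

Lemma signedE (s : signed_perm n) k : val s (sneg k) = sneg (val s k).
Proof. by case: s => s /= /forallP/(_ k)/eqP. Qed.

Lemma frame_ortho k l x y :
  l <> sneg k -> x \in L k -> y \in L l -> gram_form G x y = 0.
Proof.
move=> lk xk yl; apply: ((frame_isotropic L k l).2 lk x y).
  exact: (subvP (addvSl _ _)).
exact: (subvP (addvSr _ _)).
Qed.

Lemma signed_opp (s : signed_perm n) (i j : 'I_n) :
  val s (j, false) <> sneg (val s (i, false)).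
Proof. by rewrite -signedE => /perm_inj. Qed.

Lemma frame_flagP (s : signed_perm n) (k : 'I_n) :
  (frame_flag (val s) k.+1 != 0%VS) &&
  `[< isotropic G (frame_flag (val s) k.+1) >].
Proof.
apply/andP; split.
  rewrite -subv0; apply/negP => h.
  have : (L (val s (k, false)) <= 0)%VS.
    by apply: subv_trans h; apply: (sumv_sup k).
  by rewrite subv0 -dimv_eq0 frame_dim.
apply/asboolP => x y /memv_sumP[a ha ->] /memv_sumP[b hb ->].
rewrite gram_form_sum big1 // => i hi; rewrite big1 // => j hj.
apply: frame_ortho (ha _ hi) (hb _ hj); exact: signed_opp.
Qed.

Definition frame_vertex (s : signed_perm n) (k : 'I_n) : isotropic_poset G :=
  exist _ (frame_flag (val s) k.+1) (frame_flagP s k).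

Lemma frame_vertex_lt (s : signed_perm n) (i j : 'I_n) :
  (i < j)%N -> (frame_vertex s i < frame_vertex s j)%O.
Proof.
move=> ij; rewrite lt_neqAle; apply/andP; split; last first.
  apply/subv_sumP => k hk; apply: (sumv_sup k) => //.
  exact: leq_trans hk (ltnW _).
apply/eqP => /(congr1 val) /= e.
have hL : (L (val s (j, false)) <= frame_flag (val s) i.+1)%VS.
  by rewrite e; apply: (sumv_sup j).
set a := val s (j, false) in hL.
suff /frame_isotropic : isotropic G (L a + L (sneg a)) by [].
have sK : involutive (@sneg n) by case=> k b; rewrite /sneg /= negbK.
have sE (k : 'I_n) : (k < i.+1)%N -> sneg a <> sneg (val s (k, false)).
  move=> hk /(inv_inj sK)/perm_inj[] jk.
  by move: ij; rewrite jk ltnNge -ltnS hk.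
have ortho x y : x \in L a -> y \in L (sneg a) ->
    gram_form G x y = 0 /\ gram_form G y x = 0.
  move=> /(subvP hL)/memv_sumP[b hb ->] hy.
  have -> : y = \sum_(k < 1) y by rewrite big_ord1.
  rewrite !gram_form_sum big_ord1; split; rewrite big1 // => k hk.
    rewrite big_ord1; apply: frame_ortho (hb _ hk) hy; exact: sE.
  apply: frame_ortho hy (hb _ hk); rewrite sK => ak.
  by apply: (sE k hk); rewrite -ak.
move=> x y /memv_addP[x1 hx1 [x2 hx2 ->]] /memv_addP[y1 hy1 [y2 hy2 ->]].
have addl u v w : gram_form G (u + v) w = gram_form G u w + gram_form G v w.
  by rewrite /gram_form !mulmxDl mxE.
have addr u v w : gram_form G w (u + v) = gram_form G w u + gram_form G w v.
  by rewrite /gram_form linearD mulmxDr mxE.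
have self (k : signed_index n) : k <> sneg k by case: k => k [] [].
rewrite addl !addr (ortho _ _ hx1 hy2).1 (ortho _ _ hy1 hx2).2.
by rewrite (frame_ortho (@self a) hx1 hy1) (frame_ortho (@self _) hx2 hy2) !addr0.
Qed.

Lemma frame_simplex_subproof (s : signed_perm n) :
  let t := [seq frame_vertex s k | k <- enum 'I_n] in
  sorted <%O t && (size t == n).
Proof.
apply/andP; split; last by rewrite size_map size_enum_ord.
apply: (homo_sorted (e := fun i j : 'I_n => (i < j)%N)).
  by move=> i j; exact: frame_vertex_lt.
have := iota_ltn_sorted 0 n; rewrite -val_enum_ord.
by rewrite sorted_map.
Qed.

Definition frame_simplex (s : signed_perm n) :
    simplex (isotropic_poset G) n :=
  exist _ [seq frame_vertex s k | k <- enum 'I_n] (frame_simplex_subproof s).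

Definition apartment_chain : chain (isotropic_poset G) n :=
  \sum_(s : signed_perm n) (-1) ^+ slength (val s) *: << frame_simplex s >>.

Lemma frame_flag_sgen (s : {perm signed_index n}) (i l : 'I_n) :
  l != i -> frame_flag (sgen i * s)%g l.+1 = frame_flag s l.+1.
Proof.
move=> li; rewrite /frame_flag /sgen; case: insubP => [j _ /= ji|h].
  rewrite [RHS](reindex_inj (@perm_inj _ (tperm i j))) /=.
  apply: eq_big => [k|k _]; last by rewrite permM sswapE.
  have {}li : (l : nat) <> i by move=> /val_inj/eqP; rewrite (negPf li).
  case: tpermP => [->|->|//]; lia.
apply: eq_bigr => k kl; rewrite permM sflipE; case: eqP => // ki.
have {}li : (l : nat) <> i by move=> /val_inj/eqP; rewrite (negPf li).
have := ltn_ord l; move: kl h; rewrite ki; lia.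
Qed.

Lemma face_sgen (s : signed_perm n) (i : 'I_n) :
  face i (frame_simplex (sgen_mul i s)) = face i (frame_simplex s).
Proof.
apply: val_inj; rewrite /= -!map_take -!map_drop -!map_cat.
apply/eq_in_map => l hl; apply: val_inj; apply: frame_flag_sgen.
apply: contraTneq hl => ->.
have szi : (i < size (enum 'I_n))%N by rewrite size_enum_ord.
have := enum_uniq 'I_n; rewrite -[X in uniq X](cat_take_drop i).
rewrite (drop_nth i szi) nth_ord_enum -cat1s uniq_catCA cat1s /=.
by rewrite map_id -enumT; case/andP.
Qed.

Lemma apartment_is_cycle : apartment_chain \in is_cycle (P:=isotropic_poset G) (p:=n).
Proof.
apply/eqP; rewrite /apartment_chain raddf_sum /=.
have bdZ (e : int) s : boundary (e *: << frame_simplex s >>) =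
    \sum_(i < n) e *: ((-1) ^+ i *: << face i (frame_simplex s) >>).
  have -> : e *: << frame_simplex s >> = << e *g frame_simplex s >>
              :> {freeg (simplex (isotropic_poset G) n)}.
    by apply/eqP/freeg_eqP => x; rewrite coeffZ !coeffU mul1r.
  by rewrite /boundary liftU scaler_sumr.
under eq_bigr => s _ do rewrite bdZ.
rewrite exchange_big /= big1 // => i _.
set S := \sum_(s : signed_perm n) _.
have SN : S = - S.
  rewrite {1}/S (reindex_inj (can_inj (sgen_mulK i))) /= /S -sumrN.
  apply: eq_bigr => s _; rewrite face_sgen -scaleNr; congr (_ *: _).
  rewrite -[LHS]signr_odd -[in RHS]signr_odd.
  rewrite (odd_slength_mul (mem_sgen i) (valP s)).
  by case: (odd _); rewrite /= ?expr0 ?expr1 ?opprK.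
apply/eqP/freeg_eqP => x; rewrite coeff0.
have : coeff x S = - coeff x S by rewrite {1}SN raddfN.
lia.
Qed.

(* [Sigma_L], for the given indexing of the lines of L. *)
Definition apartment_class : reduced_homology (isotropic_poset G) n :=
  homology_class (Cycle apartment_is_cycle).

End Frames.

Section Symplectic.
Variable R : idomainType.

(* Non-degeneracy means a trivial radical; unimodularity is not required. *)
Definition symplectic_form m (w : {biscalar 'rV[R]_m}) : Prop :=
  (forall x, w x x = 0) /\ (forall x, (forall y, w x y = 0) -> x = 0).

Definition to_frac m (x : 'rV[R]_m) : 'rV[{fraction R}]_m :=
  map_mx (@tofrac R) x.

Definition gram m (w : {biscalar 'rV[R]_m}) : 'M[{fraction R}]_m :=
  \matrix_(i, j) tofrac (w (delta_mx 0 i) (delta_mx 0 j)).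

(* gram_form (gram w) is the bilinear extension of w to the fraction field. *)
Lemma gram_formE m (w : {biscalar 'rV[R]_m}) (x y : 'rV[R]_m) :
  gram_form (gram w) (to_frac x) (to_frac y) = tofrac (w x y).
Proof.
have -> : w x y = \sum_i \sum_j
    x 0 i * (y 0 j * w (delta_mx 0 i) (delta_mx 0 j)).
  rewrite {1}(row_sum_delta x) linear_sumlz; apply: eq_bigr => i _.
  rewrite linearZl_LR {1}(row_sum_delta y) linear_sumr mulr_sumr.
  by apply: eq_bigr => j _; rewrite linearZr_LR.
rewrite rmorph_sum /gram_form mxE.
under [LHS]eq_bigr => j _ do rewrite mxE mulr_suml.
rewrite exchange_big; apply: eq_bigr => i _ /=.
rewrite rmorph_sum; apply: eq_bigr => j _.
by rewrite !rmorphM !mxE -mulrA [X in _ * X]mulrC.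
Qed.

Definition symplectic_steinberg n (w : {biscalar 'rV[R]_(2 * n)}) : zmodType :=
  reduced_homology (isotropic_poset (gram w)) n.

(* Internal direct sum of the R-submodules L k `&` R^(2n). *)
Definition integral_frame n (w : {biscalar 'rV[R]_(2 * n)})
    (L : frame n (gram w)) : Prop :=
  forall x : 'rV[R]_(2 * n),
    exists! y : {ffun signed_index n -> 'rV[R]_(2 * n)},
      (forall k, to_frac (y k) \in L k) /\ x = \sum_k y k.

Definition integral_apartment_class n (w : {biscalar 'rV[R]_(2 * n)})
    (a : symplectic_steinberg w) : Prop :=
  exists2 L : frame n (gram w), integral_frame L & a = apartment_class L.

End Symplectic.

(* Main.v *)
Require Import Defs.
From HB Require Import structures.
From mathcomp Require Import all_boot all_order all_fingroup all_algebra.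
From mathcomp Require Import ring_quotient generic_quotient freeg.
From mathcomp Require Import ring zify.
From mathcomp Require Import boolp classical_sets.

Set Implicit Arguments.
Unset Strict Implicit.
Unset Printing Implicit Defensive.

Import Order.TTheory GRing.Theory.

Local Open Scope ring_scope.

(* Choose an isotropic plane [W] (all of [K^2] if [n = 1]) whose lattice
   [W :&: R^(2n)] is free, and a flag [W = W_2 < ... < W_n].  The functional
   counting the flags [V_1 < W_2 < ... < W_n] with [V_1 :&: R^(2n)] free of
   rank 1 vanishes on an integral apartment: such flags come in pairs
   [L_i, L_j] of opposite sign with [W = L_i + L_j], and if [I (+) J = R^2],
   then [I] is free if and only if [J] is.  It does not vanish on the apartment
   of a frame with two lines in [W] of which exactly one is free; such lines
   exist since [R] is not principal.  As isotropic subspaces have dimension at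
   most [n], there are no boundaries in degree [n - 1], so the functional is
   defined on homology.

   As the form may fail to be unimodular, finding [W] takes a unimodular vector
   orthogonal to a given [(p, q, r)] in [R^3]; it comes from
   [(p, q, r) = (p, q + t r)] for some [t], when [p != 0]. *)

(** * Ideals of Dedekind domains *)

Section Noetherian.
Local Open Scope classical_set_scope.
Variable R : idomainType.
Implicit Types (I J m : set R) (a b c p q r x y z : R).

Definition divides a b : Prop := exists c, b = c * a.

Definition ideal2 a b : set R := [set z | exists x y, z = x * a + y * b].

Lemma ideal2_ideal a b : is_ideal (ideal2 a b).
Proof.
split; first by exists 0, 0; ring.
  by move=> _ _ [x [y ->]] [x' [y' ->]]; exists (x + x'), (y + y'); ring.
by move=> c _ [x [y ->]]; exists (c * x), (c * y); ring.
Qed.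

Lemma ideal2l a b : ideal2 a b a. Proof. by exists 1, 0; ring. Qed.
Lemma ideal2r a b : ideal2 a b b. Proof. by exists 0, 1; ring. Qed.

Lemma ideal2_sub I a b : is_ideal I -> I a -> I b -> ideal2 a b `<=` I.
Proof. by move=> [_ ID IM] Ia Ib _ [x [y ->]]; apply: ID; apply: IM. Qed.

Lemma divides_ideal a : is_ideal [set b | divides a b].
Proof.
split; first by exists 0; ring.
  by move=> _ _ [x ->] [y ->]; exists (x + y); ring.
by move=> c _ [x ->]; exists (c * x); ring.
Qed.

Lemma ideal_sum I (k : nat) (f : 'I_k -> R) :
  is_ideal I -> (forall i, I (f i)) -> I (\sum_i f i).
Proof. by move=> [I0 ID _] If; elim/big_ind: _. Qed.

Lemma ideal_generator I (k : nat) (g : 'I_k -> R) :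
  (forall x, I x <-> exists a : 'I_k -> R, x = \sum_i a i * g i) ->
  forall i, I (g i).
Proof.
move=> gP i; apply/gP; exists (fun j => (j == i)%:R).
rewrite (bigD1 i) //= eqxx mul1r big1 ?addr0 // => j /negPf ->.
by rewrite mul0r.
Qed.

(** If no member of [F] were maximal, choice would produce a strictly ascending chain in [F]; the
    generators of its union all lie in one term, where the chain would stop. *)
Lemma noetherian_maximal (F : set (set R)) : noetherian R ->
  (forall I, F I -> is_ideal I) -> (exists I, F I) ->
  exists2 I, F I & forall J, F J -> I `<=` J -> J = I.
Proof.
move=> noeth Fi [I0 FI0]; apply: contrapT => nomax.
(* The guard [F I] sits under the existential so that [choice] yields a successor function on all
   sets. *)
have step I : exists J, F I -> [/\ F J, I `<=` J & J <> I].
  have [FI|nFI] := pselect (F I); last by exists I.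
  apply: contrapT => nJ; apply: nomax; exists I => // J FJ IJ.
  by apply: contrapT => JI; apply: nJ; exists J.
have [f fP] := choice step.
pose ch k := iter k f I0.
have Fch k : F (ch k) by elim: k => //= k /fP[].
have chS k : ch k `<=` ch k.+1 by have [] := fP _ (Fch k).
have ch_le k l : (k <= l)%N -> ch k `<=` ch l.
  move=> /subnKC <-; elim: (l - k)%N => [|j IH]; first by rewrite addn0.
  by rewrite addnS => x /IH; exact: chS.
pose U : set R := [set x | exists k, ch k x].
have Ui : is_ideal U.
  split; first by exists 0%N; have [] := Fi _ (Fch 0%N).
    move=> x y [k kx] [l ly]; exists (maxn k l).
    have [_ ID _] := Fi _ (Fch (maxn k l)).
    apply: ID; first exact: ch_le (leq_maxl _ _) _ kx.
    exact: ch_le (leq_maxr _ _) _ ly.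
  by move=> a x [k kx]; exists k; have [_ _ IM] := Fi _ (Fch k); exact: IM.
have [k [g gP]] := noeth U Ui.
have Ug i : exists l, ch l (g i) by exact: ideal_generator gP i.
have [N NP] := choice Ug.
pose M := (\max_i N i)%N.
have UM : U `<=` ch M.
  move=> x /gP[a ->]; have Mi := Fi _ (Fch M); apply: (ideal_sum Mi) => i.
  have [_ _ IM] := Mi; apply: IM; apply: ch_le (NP i).
  exact: (@leq_bigmax _ N i).
have [_ _ ne] := fP _ (Fch M); apply: ne; apply/seteqP; split; last exact: chS.
by move=> x hx; apply: UM; exists M.+1.
Qed.

Lemma exists_maximal_ideal I : noetherian R -> is_ideal I -> ~ I 1 ->
  exists2 m, is_maximal_ideal m & I `<=` m.
Proof.
move=> noeth Ii I1.
pose F : set (set R) := [set J | [/\ is_ideal J, ~ J 1 & I `<=` J]].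
have [|/=|m [mi m1 Im] mmax] := @noetherian_maximal F noeth.
- by move=> J [].
- by exists I; split.
exists m => //; split=> // J Ji mJ J1; apply: mmax => //; split=> // x /Im.
exact: mJ.
Qed.

Lemma maximal_ideal_unit m w : is_maximal_ideal m -> ~ m w ->
  exists2 n, m n & exists c, 1 = n + c * w.
Proof.
move=> [mi m1 mmax] mw; apply: contrapT => nu.
pose J : set R := [set z | exists2 n, m n & exists c, z = n + c * w].
have [m0 mD mM] := mi.
have Ji : is_ideal J.
  split; first by exists 0 => //; exists 0; ring.
    move=> _ _ [n mn [c ->]] [n' mn' [c' ->]].
    by exists (n + n'); [exact: mD|exists (c + c'); ring].
  move=> a _ [n mn [c ->]].
  by exists (a * n); [exact: mM|exists (a * c); ring].
have JE : J = m.
  by apply: mmax => // x mx; exists x => //; exists 0; ring.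
by apply: mw; rewrite -JE; exists 0 => //; exists 1; ring.
Qed.

Lemma maximal_ideal_prime m : is_maximal_ideal m -> is_prime_ideal m.
Proof.
move=> mm; have [mi m1 _] := mm; split=> // x y mxy.
apply: contrapT => /not_orP[mx my].
have [n mn [c e]] := maximal_ideal_unit mm mx.
have [_ mD mM] := mi.
apply: my; have -> : y = y * n + c * (x * y) by rewrite -[LHS]mulr1 e; ring.
by apply: mD; apply: mM.
Qed.

End Noetherian.

(** * Localization in Dedekind domains, stable range, and a criterion for principality *)

Section Dedekind.
Local Open Scope classical_set_scope.
Variables (R : idomainType) (R_dedekind : dedekind_domain R).
Implicit Types (I J m N : set R) (a b c p q r x y z : R).

Let noeth : noetherian R. Proof. by case: R_dedekind. Qed.

(* Cayley-Hamilton: [b / a] is an eigenvalue of the matrix of its action on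
   generators of [J]. *)
Lemma integral_multiplier J a b : is_ideal J -> (exists2 x, J x & x != 0) ->
  a != 0 -> (forall x, J x -> exists2 y, J y & b * x = a * y) -> divides a b.
Proof.
move=> Ji [x0 Jx0 x0n0] an0 bJ.
have [k [g gP]] := noeth Ji.
have Jg i : J (g i) by exact: ideal_generator gP i.
have /choice[A AP] i : exists c : 'I_k -> R, b * g i = a * \sum_j c j * g j.
  have [y Jy ->] := bJ _ (Jg i).
  by have /gP[c ->] := Jy; exists c.
pose F := {fraction R}; pose f : R -> F := @tofrac R.
pose M : 'M[R]_k := \matrix_(i, j) A j i.
pose v : 'rV[F]_k := \row_i f (g i).
have fa : f a != 0 by rewrite tofrac_eq0.
have ev : eigenvalue (map_mx f M) (f b / f a).
  apply/eigenvalueP; exists v.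
    apply/rowP => i; rewrite !mxE.
    apply: (mulfI fa); rewrite mulrA mulrCA divff // mulr1.
    rewrite -rmorphM AP rmorphM rmorph_sum; congr (_ * _).
    by apply: eq_bigr => j _; rewrite !mxE rmorphM mulrC.
  apply/eqP => v0; move/eqP: x0n0; apply.
  have /gP[c ->] := Jx0; rewrite big1 // => i _.
  have /rowP/(_ i) := v0; rewrite !mxE => /eqP.
  by rewrite tofrac_eq0 => /eqP ->; rewrite mulr0.
have [_ ic _] := R_dedekind.
have [|c e] := ic (f b / f a).
  exists (char_poly M); first exact: char_poly_monic.
  by rewrite map_char_poly -eigenvalue_root_char.
exists c; apply/eqP; rewrite -tofrac_eq rmorphM /=.
by rewrite -e divfK.
Qed.

(* [m] is an associated prime of [R / N], because it is minimal over [N]. *)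
Lemma maximal_ideal_colon m N : is_maximal_ideal m -> is_ideal N ->
  (exists2 x, N x & x != 0) -> N `<=` m ->
  exists2 b, ~ N b & forall x, m x -> N (b * x).
Proof.
move=> mm Ni [x0 Nx0 x0n0] Nm.
have [mi m1 mP] := maximal_ideal_prime mm.
have [N0 ND NM] := Ni.
pose colon b : set R := [set x | N (b * x)].
have colon_ideal b : is_ideal (colon b).
  split; rewrite /colon /=; first by rewrite mulr0.
    by move=> x y ? ?; rewrite mulrDr; exact: ND.
  by move=> a x ?; rewrite mulrCA; exact: NM.
(* A maximal colon ideal [(N : b)] inside [m] is prime and contains [x0], so dimension one makes it
   maximal, hence equal to [m]. *)
pose F : set (set R) := [set I | exists2 b, I = colon b & I `<=` m].
have [||_ [b -> bm] bmax] := @noetherian_maximal _ F noeth.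
- by move=> _ [b -> _].
- exists (colon 1); exists 1 => // x; rewrite /colon /= mul1r; exact: Nm.
have bP : is_prime_ideal (colon b).
  split=> [//|/bm//|x y bxy]; apply: contrapT => /not_orP[bx by'].
  (* If [(N : b x)] lies in [m], it equals [(N : b)] and contains [y]. Otherwise [b x z] is in [N]
     for some [z] outside [m], and then [(N : b z) = (N : b)] contains [x]. *)
  have [bxm|] := pselect (colon (b * x) `<=` m).
    have E : colon (b * x) = colon b.
      apply: bmax; first by exists (b * x).
      move=> z; rewrite /colon /= => bz.
      have -> : b * x * z = x * (b * z) by ring.
      exact: NM.
    by apply: by'; rewrite -E /colon /= -mulrA.
  move=> /existsNP[z /not_implyP[bxz mz]].
  have E : colon (b * z) = colon b.
    apply: bmax.
      exists (b * z) => // z' hz'; have : colon b (z * z') by rewrite /colon /= mulrA.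
      by move/bm/mP => [].
    move=> z'; rewrite /colon /= => bz'.
    have -> : b * z * z' = z * (b * z') by ring.
    exact: NM.
  by apply: bx; rewrite -E /colon /= mulrAC.
have [_ _ dim1] := R_dedekind.
have [|_ _ cmax] := dim1 _ bP.
  by exists x0 => //; rewrite /colon /=; exact: NM.
have Em : m = colon b by apply: cmax.
exists b => [Nb|x]; first by apply: m1; rewrite Em /colon /= mulr1.
by rewrite Em.
Qed.

(** The localization at [m] is a valuation ring. If [q] and [r] were incomparable there, every
    relation [q z = y r] would have [y] and [z] in [m]. For [b] outside [(q)] with [b m] inside
    [(q)], the fraction [b / q] would then map the ideal [(q : r)] into itself, so [q] would divide
    [b] by integral closedness. *)
Lemma locally_comparable m q r : is_maximal_ideal m ->
  exists2 x, ~ m x & divides r (x * q) \/ divides q (x * r).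
Proof.
move=> mm; have [mi m1 mP] := maximal_ideal_prime mm.
have [->|qn0] := eqVneq q 0.
  by exists 1 => //; left; exists 0; ring.
apply: contrapT => ncomp.
have both y z : q * z = y * r -> m y /\ m z.
  move=> e; split; apply: contrapT => h; apply: ncomp.
    by exists y => //; right; exists z; rewrite -e mulrC.
  by exists z => //; left; exists y; rewrite mulrC e.
have mq : m q by have [] := both q r erefl.
have [||b nb bm] := maximal_ideal_colon mm (divides_ideal q).
- by exists q => //; exists 1; ring.
- by move=> _ [c ->]; have [_ _ mM] := mi; exact: mM.
apply: nb; apply: (@integral_multiplier [set y | divides q (y * r)]) => //.
- split=> /=; first by exists 0; ring.
    move=> x y [c e] [c' e']; exists (c + c').
    by rewrite mulrDl e e' mulrDl.
  by move=> a x [c e]; exists (a * c); rewrite -mulrA e mulrA.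
- by exists q => //=; exists r; rewrite mulrC.
move=> y [z e].
have [/bm[y1 e1] /bm[z1 e2]] : m y /\ m z by apply: both; rewrite e mulrC.
exists y1; last by rewrite e1 mulrC.
exists z1; apply: (mulfI qn0).
have -> : q * (y1 * r) = (y1 * q) * r by ring.
have -> : q * (z1 * q) = q * (b * z) by rewrite e2; ring.
by rewrite -e1 -mulrA e; ring.
Qed.

(* The ring [R / p] is Artinian; [e] lifts the idempotent that projects it to
   its local factor at [m]. *)
Lemma local_idempotent m p : is_maximal_ideal m -> m p -> p != 0 ->
  exists e, [/\ ~ m e, divides p (e * (1 - e)) &
    forall w, ~ m w -> exists w', divides p (e * w * w' - e)].
Proof.
move=> mm mp pn0; have [mi m1 mP] := maximal_ideal_prime mm.
have [m0 mD mM] := mi.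
(* The kernel of the map from [R] to the localization of [R / p] at [m]. *)
pose N : set R := [set x | exists2 w, ~ m w & divides p (w * x)].
have Ni : is_ideal N.
  split; first by exists 1 => //; exists 0; ring.
    move=> x y [w mw [c e]] [w' mw' [c' e']]; exists (w * w').
      by move/mP => [].
    exists (w' * c + w * c').
    have -> : w * w' * (x + y) = w' * (w * x) + w * (w' * y) by ring.
    by rewrite e e'; ring.
  move=> a x [w mw [c e]]; exists w => //; exists (a * c).
  by rewrite mulrCA e mulrA.
have Nm : N `<=` m.
  move=> x [w mw [c e]]; have : m (w * x) by rewrite e; exact: mM.
  by move/mP => [].
have Nnz : exists2 x, N x & x != 0.
  by exists p => //; exists 1 => //; exists 1; ring.
(* Otherwise some [b] outside [N] would have [b w] in [N]; but factors outside [m] can be cancelled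
   modulo [N]. *)
have coprime w : ~ m w -> exists2 x, N x & exists c, 1 = x + c * w.
  move=> mw; apply: contrapT => ncop.
  pose J : set R := [set z | exists2 x, N x & exists c, z = x + c * w].
  have [N0 ND NM] := Ni.
  have Ji : is_ideal J.
    split; first by exists 0 => //; exists 0; ring.
      move=> _ _ [x Nx [c ->]] [x' Nx' [c' ->]].
      by exists (x + x'); [exact: ND|exists (c + c'); ring].
    move=> a _ [x Nx [c ->]].
    by exists (a * x); [exact: NM|exists (a * c); ring].
  have [//|m' mm' Jm'] := exists_maximal_ideal noeth Ji.
  have [|b Nb bm'] := maximal_ideal_colon mm' Ni Nnz.
    by move=> x Nx; apply: Jm'; exists x => //; exists 0; ring.
  have [|w' mw' h] := bm' w; first by apply: Jm'; exists 0 => //; exists 1; ring.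
  apply: Nb; exists (w' * w); first by move/mP => [].
  by move: h; rewrite -mulrA [w * b]mulrC.
(* A common multiplier for all of [N]: the product of those of finitely many generators. *)
have [w0 mw0 w0N] : exists2 w0, ~ m w0 & forall x, N x -> divides p (w0 * x).
  have [k [g gP]] := noeth Ni.
  have Ng i : N (g i) by exact: ideal_generator gP i.
  have /choice[w wP] i : exists w, ~ m w /\ divides p (w * g i).
    by have [w] := Ng i; exists w.
  exists (\prod_i w i).
    elim/big_ind: _ => // [x y mx my /mP[] //|i _]; by have [] := wP i.
  move=> x /gP[a ->]; rewrite mulr_sumr.
  apply: (ideal_sum (divides_ideal p)) => i.
  have [_ [c e]] := wP i; exists (\prod_(j | j != i) w j * a i * c).
  rewrite (bigD1 i) //= -[RHS]mulrA -e; ring.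
have [n0 Nn0 [c ec]] := coprime _ mw0.
(* Its complement [1 - c * w0] is [n0], an element of [N], which [w0] kills modulo [p]. *)
exists (c * w0); split.
- move=> me; apply: m1; rewrite ec; apply: mD => //; exact: Nm.
- have -> : 1 - c * w0 = n0 by rewrite ec; ring.
  by have [d e] := w0N _ Nn0; exists (c * d); rewrite -mulrA e mulrA.
move=> w /coprime[n1 Nn1 [w' ew]]; exists w'.
have [d e] := w0N _ Nn1; exists (- (c * d)).
have -> : c * w0 * w * w' - c * w0 = c * w0 * (w' * w - 1) by ring.
have -> : w' * w - 1 = - n1 by rewrite ew; ring.
by rewrite mulrN mulNr -mulrA e mulrA.
Qed.

(** Choose [t] with [ideal2 p (q + t * r)] maximal. If [r] were missing, let [m] contain all
    multipliers of [r] into this ideal, and let [e] be the idempotent modulo [p] at [m]. Replacing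
    [t] by [t + e] gives an ideal containing the old one and [e * r], although [e] is not in [m]. *)
Lemma ideal_stable_range p q r : p != 0 ->
  exists t, ideal2 p (q + t * r) r.
Proof.
move=> pn0.
pose F : set (set R) := [set I | exists t, I = ideal2 p (q + t * r)].
have [||_ [t ->] Dmax] := @noetherian_maximal _ F noeth.
- by move=> _ [t ->]; exact: ideal2_ideal.
- by exists (ideal2 p (q + 0 * r)), 0.
exists t; apply: contrapT => Dr.
set q0 := q + t * r in Dmax Dr.
have [D0 DD DM] := ideal2_ideal p q0.
have [||m mm Cm] := @exists_maximal_ideal _ [set x | ideal2 p q0 (x * r)] noeth.
- split=> /=; first by rewrite mul0r.
    by move=> x y ? ?; rewrite mulrDl; exact: DD.
  by move=> a x ?; rewrite -mulrA; exact: DM.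
- by rewrite /= mul1r.
have [mi m1 mP] := maximal_ideal_prime mm; have [m0 mD mM] := mi.
have mp : m p by apply: Cm => /=; rewrite mulrC; apply: DM; exact: ideal2l.
have [e [me [d ee] eu]] := local_idempotent mm mp pn0.
(* If [q0] divided [x * r], then [x] would multiply [r] into [ideal2 p q0] and lie in [m]; so [q0]
   is locally a multiple of [r]. *)
have [x mx [[y xy]|[y xy]]] := locally_comparable q0 r mm; last first.
  by apply: mx; apply: Cm; rewrite /= xy; apply: DM; exact: ideal2r.
have my : m y.
  by apply: Cm; rewrite /= -xy; apply: DM; exact: ideal2r.
set D' := ideal2 p (q0 + e * r).
have D'i : is_ideal D' by exact: ideal2_ideal.
have [_ DD' DM'] := D'i.
have D'p c : D' (c * p) by apply: DM'; exact: ideal2l.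
have D'q : D' (q0 + e * r) by exact: ideal2r.
have D'N a : D' a -> D' (- a) by move=> /(DM' (-1)); rewrite mulN1r.
have mw : ~ m (y + x * e).
  move=> mw; have : m (x * e).
    have -> : x * e = (y + x * e) + (-1) * y by ring.
    by apply: mD => //; exact: mM.
  by move/mP => [].
(* [x * (q0 + e * r) = (y + x * e) * r], and [y + x * e] is invertible modulo [p] on the factor cut
   out by [e]. *)
have D'er : D' (e * r).
  have [w' [c ec]] := eu _ mw.
  have -> : e * r = e * w' * (x * (q0 + e * r)) + - (r * c * p).
    rewrite -[X in - X]mulrA -ec mulrDr xy; ring.
  by apply: DD'; [apply: (DM'); apply: (DM')|apply: D'N].
(* Modulo [p], [(1 - e) * q0] equals [(1 - e) * (q0 + e * r)], and [e * q0] is a multiple of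
   [e * r]. *)
have D'q0 : D' q0.
  have [x' [c ec]] := eu _ mx.
  have -> : q0 = (1 - e) * (q0 + e * r) + - (r * (d * p)) +
                 (x' * y * (e * r) + - (q0 * (c * p))).
    rewrite -ee -ec.
    have -> : x' * y * (e * r) = x' * e * (y * r) by ring.
    by rewrite -xy; ring.
  by apply: (DD'); apply: (DD'); first [apply: D'N; apply: (DM')|apply: (DM')].
have DE : D' = ideal2 p q0.
  apply: Dmax; last by apply: ideal2_sub => //; exact: ideal2l.
  by exists (t + e); rewrite /D' /q0; congr ideal2; ring.
by apply: me; apply: Cm; rewrite /= -DE.
Qed.

Lemma orthogonal_unimodular p q r : exists x y z,
  x * p + y * q + z * r = 0 /\ exists a b c, a * x + b * y + c * z = 1.
Proof.
have [->|pn0] := eqVneq p 0.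
  by exists 1, 0, 0; split; [ring|exists 1, 0, 0; ring].
have [t [a [b e]]] := ideal_stable_range q r pn0.
(* Orthogonality is a rewriting of [r = a * p + b * (q + t * r)]; the pairing with [(0, - t, 1)] is
   [b * t + (1 - b * t)]. *)
exists (- a), (- b), (1 - b * t); split; last by exists 0, (- t), 1; ring.
have -> : - a * p + - b * q + (1 - b * t) * r = r - (a * p + b * (q + t * r)).
  by ring.
by rewrite -e subrr.
Qed.

(** For [(a, b)] nonzero: the points of [R^2] on the line through [(a, b)] form a cyclic module,
    generated by [(c, d)]. *)
Definition cyclic_line a b : Prop :=
  exists c d, c * b = d * a /\
    forall x y, x * b = y * a -> exists e, x = e * c /\ y = e * d.

(** The generator [(c, d)] is unimodular, so the factor [g] in [(a, b) = g (c, d)] generates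
    [ideal2 a b]. Indeed, if a maximal ideal [m] contained [c] and [d], take [x] nonzero in [m] and
    [b'] outside [(x)] with [b' m] inside [(x)]: the point [(b' / x) (c, d)] would be an integral
    point of the line but not a multiple of [(c, d)]. *)
Lemma cyclic_line_bezout a b : (a != 0) || (b != 0) -> cyclic_line a b ->
  exists g, [/\ ideal2 a b g, divides g a & divides g b].
Proof.
move=> ab [c [d [cd cdP]]].
have [g [ga gb]] := cdP a b (mulrC _ _).
suff [x [y e]] : ideal2 c d 1.
  exists g; split; [exists x, y|by exists c; rewrite mulrC|by exists d; rewrite mulrC].
  by rewrite -[LHS]mulr1 e ga gb; ring.
apply: contrapT => cd1.
have [m mm cdm] := exists_maximal_ideal noeth (ideal2_ideal c d) cd1.
have [mi _ _] := maximal_ideal_prime mm.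
have [x mx xn0] : exists2 x, m x & x != 0.
  have [c0|cn0] := eqVneq c 0; last first.
    by exists c => //; apply: cdm; exact: ideal2l.
  exists d; first by apply: cdm; exact: ideal2r.
  apply: contraTneq ab => d0; rewrite ga gb c0 d0 mulr0.
  by rewrite eqxx.
have [||b' nb' b'm] := maximal_ideal_colon mm (divides_ideal x).
- by exists x => //; exists 1; ring.
- by move=> _ [z ->]; have [_ _ mM] := mi; exact: mM.
have [c1 ec] := b'm c (cdm _ (ideal2l c d)).
have [d1 ed] := b'm d (cdm _ (ideal2r c d)).
have [|f [fc fd]] := cdP c1 d1.
  apply: (mulfI xn0).
  have -> : x * (c1 * b) = b' * (c * b) by rewrite mulrCA mulrA -ec; ring.
  by rewrite cd mulrA ed; ring.
apply: nb'; exists f.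
have [c0|cn0] := eqVneq c 0; last first.
  by apply: (mulIf cn0); rewrite ec fc; ring.
have [d0|dn0] := eqVneq d 0.
  by move: ab; rewrite ga gb c0 d0 mulr0 eqxx.
by apply: (mulIf dn0); rewrite ed fd; ring.
Qed.

(** Take a maximal principal ideal [(g)] inside [I]. For [x] in [I], the ideal generated by [x] and
    [g] is again principal and inside [I], so it equals [(g)]. *)
Lemma cyclic_lines_principal :
  (forall a b, (a != 0) || (b != 0) -> cyclic_line a b) ->
  forall I, is_ideal I -> exists2 g, I g & forall x, I x -> divides g x.
Proof.
move=> cyc I Ii; have [I0 ID IM] := Ii.
pose F : set (set R) := [set J | exists2 g, J = [set x | divides g x] & I g].
have [||_ [g -> Ig] gmax] := @noetherian_maximal _ F noeth.
- by move=> _ [g -> _]; exact: divides_ideal.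
- by exists [set x | divides 0 x]; exists 0.
exists g => // x Ix.
have [xg|] := boolP ((x != 0) || (g != 0)); last first.
  by rewrite negb_or !negbK => /andP[/eqP -> _]; exists 0; ring.
have [k [kxg kx kg]] := cyclic_line_bezout xg (cyc _ _ xg).
have kE : [set y | divides k y] = [set y | divides g y].
  apply: gmax; first by exists k => //; apply: (ideal2_sub Ii Ix Ig).
  by move=> _ [c ->]; have [c' ->] := kg; exists (c * c'); ring.
by have : [set y | divides k y] x by []; rewrite kE.
Qed.

End Dedekind.

(** * Projective modules of rank 1 *)

Section ClassNumber.
Variable R : idomainType.

(** A surjection from ['rV[R]_k] splits, so [P] embeds by [h]. A coordinate of [h] that is nonzero
    on [v ord0] is injective: a nonzero [x] in its kernel would be independent of [v ord0], against
    rank 1. *)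
Lemma rank1_projective_ideal (P : lmodType R) : rank1_projective P ->
  exists f : {linear P -> R^o}, injective f /\ exists x, f x != 0.
Proof.
move=> [[k [g gP]] proj [[v vli] rk]].
pose F (x : 'rV[R]_k) : P := \sum_i x 0 i *: g i.
have Flin : linear F.
  move=> a x y; rewrite /F scaler_sumr -big_split; apply: eq_bigr => i _ /=.
  by rewrite !mxE scalerDl scalerA.
pose Fl : {linear 'rV[R]_k -> P} :=
  HB.pack F (GRing.isLinear.Build _ _ _ _ F Flin).
have [|h hK] := proj _ _ Fl (idfun : {linear P -> P}).
  move=> x; have [a ->] := gP x; exists (\row_i a i).
  by rewrite /= /F; apply: eq_bigr => i _; rewrite mxE.
have hinj x : h x = 0 -> x = 0.
  by move=> e; rewrite -[LHS](hK x) e linear0.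
have v0 : v ord0 != 0.
  apply/eqP => e; have H : \sum_i 1 *: v i = 0 by rewrite big_ord1 e scaler0.
  by have /eqP := vli (fun=> 1) H ord0; rewrite oner_eq0.
have [i hi] : exists i, h (v ord0) 0 i != 0.
  apply/existsP; apply: contraNT v0; rewrite negb_exists => /forallP h0.
  apply/eqP/hinj/rowP => i; rewrite mxE; apply/eqP/negbNE; exact: h0.
pose f (x : P) : R^o := h x 0 i.
have flin : linear f by move=> a x y; rewrite /f linearP !mxE.
pose fl : {linear P -> R^o} :=
  HB.pack f (GRing.isLinear.Build _ _ _ _ f flin).
exists fl; split; last by exists (v ord0).
suff f0 x : f x = 0 -> x = 0.
  move=> x y e; apply/eqP; rewrite -subr_eq0; apply/eqP/f0.
  by rewrite -[f _]/(fl _) linearB /= -[f x]/(fl x) e subrr.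
move=> fx; apply: contrapT => xn0.
have := rk 2%N (fun j : 'I_2 => if j == ord0 then v ord0 else x).
suff H : lin_indep (fun j : 'I_2 => if j == ord0 then v ord0 else x).
  by move=> /(_ H).
move=> a; rewrite big_ord_recl big_ord1 /= => e.
have a0 : a ord0 = 0.
  have := congr1 f e; rewrite flin -[f 0]/(fl 0) linear0 => /eqP.
  have -> : f (a (fintype.lift ord0 ord0) *: x) = 0.
    by rewrite /f linearZ mxE -[h x 0 i]/(f x) fx mulr0.
  by rewrite addr0 mulf_eq0 (negPf hi) orbF => /eqP.
move: e; rewrite a0 scale0r add0r => e j.
have [->//|j0] := eqVneq j ord0.
have -> : j = fintype.lift ord0 ord0 by apply: val_inj; case: j j0 => [[|[|]]].
apply: contrapT => /eqP an0; apply: xn0; apply: hinj; apply/rowP => l.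
have := congr1 (fun z => h z 0 l) e; rewrite linearZ linear0 !mxE => /eqP.
by rewrite mulf_eq0 (negPf an0) => /eqP.
Qed.

(** [P] embeds as an ideal of [R]; a preimage of a generator of that ideal is a basis. *)
Lemma rank1_projective_free (P : lmodType R) :
  (forall I : set R, is_ideal I ->
     exists2 g, I g & forall x, I x -> divides g x) ->
  rank1_projective P -> exists p : P,
    (forall x, exists a, x = a *: p) /\ (forall a, a *: p = 0 -> a = 0).
Proof.
move=> pid /rank1_projective_ideal[f [finj [x0 fx0]]].
have [|_ [p _ <-] pP] := pid (fun y => exists2 x, True & f x = y).
  split; first by exists 0 => //; rewrite linear0.
    by move=> _ _ [x _ <-] [y _ <-]; exists (x + y) => //; rewrite linearD.
  by move=> a _ [x _ <-]; exists (a *: x) => //; rewrite linearZ.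
exists p; split.
  move=> x; have [|a e] := pP (f x); first by exists x.
  by exists a; apply: finj; rewrite linearZ.
have fp : f p != 0.
  apply: contraNneq fx0 => e; have [|a ->] := pP (f x0); first by exists x0.
  by rewrite e mulr0.
move=> a /(congr1 f); rewrite linearZ linear0 => /eqP.
by rewrite mulf_eq0 (negPf fp) orbF => /eqP.
Qed.

Lemma free_rank1_iso (P Q : lmodType R) (p : P) (q : Q) :
  (forall x, exists a, x = a *: p) -> (forall a, a *: p = 0 -> a = 0) ->
  (forall x, exists a, x = a *: q) -> (forall a, a *: q = 0 -> a = 0) ->
  module_iso P Q.
Proof.
move=> pg p0 qg q0; have [c cP] := choice pg.
have pinj a b : a *: p = b *: p -> a = b.
  by move/eqP; rewrite -subr_eq0 -scalerBl => /eqP/p0/eqP; rewrite subr_eq0 => /eqP.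
have qinj a b : a *: q = b *: q -> a = b.
  by move/eqP; rewrite -subr_eq0 -scalerBl => /eqP/q0/eqP; rewrite subr_eq0 => /eqP.
pose f (x : P) : Q := c x *: q.
have flin : linear f.
  move=> a x y; rewrite /f scalerA -scalerDl; congr (_ *: _); apply: pinj.
  by rewrite scalerDl -scalerA -!cP.
pose fl : {linear P -> Q} :=
  HB.pack f (GRing.isLinear.Build _ _ _ _ f flin).
have [d dP] := choice qg.
exists fl; exists (fun y => d y *: p) => [x|y] /=.
  by rewrite [RHS]cP; congr (_ *: _); apply: qinj; rewrite -dP.
by rewrite [RHS]dP; congr (_ *: _); apply: pinj; rewrite -cP.
Qed.

(** If all lines were cyclic, [R] would be principal and every projective module of rank 1 free, so
    two distinct representatives of classes would be isomorphic. *)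
Lemma exists_noncyclic_line h : dedekind_domain R -> class_number R h ->
  (2 <= h)%N -> exists a b : R, b != 0 /\ ~ cyclic_line a b.
Proof.
move=> dR [P [Prk Pinj _]] h2; apply: contrapT => allcyc.
have pid := @cyclic_lines_principal R dR _.
have /pid {}pid (a b : R) : (a != 0) || (b != 0) -> cyclic_line a b.
  have [->|bn0 _] := eqVneq b 0; last first.
    by apply: contrapT => nc; apply: allcyc; exists a, b.
  (* For [b = 0] the line is generated by [(1, 0)]. *)
  rewrite orbF => an0; exists 1, 0; split; first by ring.
  move=> x y; rewrite mulr0 => /esym/eqP; rewrite mulf_eq0 (negPf an0) orbF.
  by move=> /eqP ->; exists x; split; ring.
have h0 : (0 < h)%N by exact: ltnW.
have [p [pg p0]] := rank1_projective_free pid (Prk (Ordinal h0)).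
have [q [qg q0]] := rank1_projective_free pid (Prk (Ordinal h2)).
by have /(congr1 val) := Pinj _ _ (free_rank1_iso pg p0 qg q0).
Qed.

End ClassNumber.

(** * Alternating forms and symplectic frames *)

Section AlternatingForm.
Variables (K : fieldType) (m : nat) (G : 'M[K]_m).
Implicit Types (x y z : 'rV[K]_m) (V : {vspace 'rV[K]_m}).

Local Notation B := (gram_form G).

Lemma gram_formDl x y z : B (x + y) z = B x z + B y z.
Proof. by rewrite /gram_form !mulmxDl mxE. Qed.

Lemma gram_formDr x y z : B z (x + y) = B z x + B z y.
Proof. by rewrite /gram_form linearD mulmxDr mxE. Qed.

Lemma gram_formZl a x y : B (a *: x) y = a * B x y.
Proof. by rewrite /gram_form -!scalemxAl mxE. Qed.

Lemma gram_formZr a x y : B x (a *: y) = a * B x y.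
Proof. by rewrite /gram_form linearZ -scalemxAr mxE. Qed.

Lemma gram_form_suml (I : finType) (P : pred I) (f : I -> 'rV[K]_m) y :
  B (\sum_(i | P i) f i) y = \sum_(i | P i) B (f i) y.
Proof. by rewrite /gram_form !mulmx_suml summxE. Qed.

Lemma gram_form_sumr (I : finType) (P : pred I) (f : I -> 'rV[K]_m) y :
  B y (\sum_(i | P i) f i) = \sum_(i | P i) B y (f i).
Proof. by rewrite /gram_form linear_sum mulmx_sumr summxE. Qed.

Hypothesis G_unit : G \in unitmx.

(** With a basis of [V] as the rows of [A], the product of [A *m G] and [A^T] vanishes; both have
    rank [\dim V], and the ranks of two such factors add up to at most [m]. *)
Lemma isotropic_dim V : isotropic G V -> (2 * \dim V <= m)%N.
Proof.
move=> isoV; pose A : 'M[K]_(\dim V, m) := \matrix_i (vbasis V)`_i.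
have rA : row_free A.
  apply: inj_row_free => v; rewrite mulmx_sum_row => e.
  have /freeP fb := basis_free (vbasisP V).
  apply/rowP => i; rewrite mxE; apply: (fb (fun j => v 0 j)).
  by rewrite -[RHS]e; apply: eq_bigr => j _; rewrite rowK.
have AGA : A *m G *m A^T = 0.
  apply/matrixP => i j; rewrite [RHS]mxE.
  have bV (l : 'I_(\dim V)) : (vbasis V)`_l \in V.
    by apply: vbasis_mem; apply: mem_nth; rewrite size_tuple.
  rewrite -[RHS](isoV _ _ (bV i) (bV j)) /gram_form.
  have rE (l : 'I_(\dim V)) : (vbasis V)`_l = row l A by rewrite rowK.
  by rewrite !rE -!row_mul !mxE; apply: eq_bigr => l _; rewrite !mxE.
have := mulmx0_rank_max AGA.
rewrite mxrankMfree ?row_free_unit // mxrank_tr.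
by move/eqP: rA => ->; rewrite addnn mul2n.
Qed.

Lemma gram_form_dual x : x != 0 -> exists y, B x y = 1.
Proof.
move=> xn0; have : x *m G != 0.
  by apply: contraNneq xn0 => e; rewrite -[x](mulmxK G_unit) e mul0mx.
move=> /rV0Pn[i xi]; exists (((x *m G) 0 i)^-1 *: delta_mx 0 i).
rewrite gram_formZr /gram_form; apply: (mulfI xi).
by rewrite mulrA divff // mul1r mulr1 trmx_delta -colE mxE.
Qed.

Hypothesis G_alt : forall x, B x x = 0.

Lemma gram_formC x y : B x y = - B y x.
Proof.
have := G_alt (x + y); rewrite gram_formDl !gram_formDr !G_alt add0r addr0.
by move/eqP; rewrite addr_eq0 => /eqP.
Qed.

Lemma isotropic_lines x y : B x y = 0 -> isotropic G (<[x]> + <[y]>)%VS.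
Proof.
move=> xy x1 y1 /memv_addP[_ /vlineP[a ->] [_ /vlineP[b ->] ->]].
move=> /memv_addP[_ /vlineP[c ->] [_ /vlineP[d ->] ->]].
rewrite gram_formDl !gram_formDr !gram_formZl !gram_formZr.
by rewrite !G_alt xy (gram_formC y x) xy oppr0 !mulr0 !addr0.
Qed.

(** A partial symplectic basis of [j] hyperbolic pairs, with [b i false] and [b i true] pairing to
    1. Natural indices let a family be extended without casts. *)
Definition hyperbolic (j : nat) (b : nat -> bool -> 'rV[K]_m) : Prop :=
  forall i i' s s', (i < j)%N -> (i' < j)%N ->
    B (b i s) (b i' s') = if (i == i') && (s' == ~~ s) then (-1) ^+ s else 0.

(** Symplectic Gram-Schmidt: a vector [y0] dual to [x] is made orthogonal to the given pairs, which
    leaves its pairing with [x] unchanged. *)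
Lemma hyperbolic_extend j b x : hyperbolic j b -> x != 0 ->
  (forall i s, (i < j)%N -> B x (b i s) = 0) ->
  exists b', [/\ hyperbolic j.+1 b', forall i, (i < j)%N -> b' i = b i
               & b' j false = x].
Proof.
move=> hb xn0 xb; have [y0 xy0] := gram_form_dual xn0.
pose y := y0 - \sum_(i < j) \sum_(s : bool)
  ((-1) ^+ s * B (b i s) y0) *: b i (~~ s).
have yE z : B z y = B z y0 - \sum_(i < j) \sum_(s : bool)
    ((-1) ^+ s * B (b i s) y0) * B z (b i (~~ s)).
  rewrite /y -scaleN1r gram_formDr gram_formZr mulN1r gram_form_sumr.
  congr (_ - _); apply: eq_bigr => i _; rewrite gram_form_sumr.
  by apply: eq_bigr => s _; rewrite gram_formZr.
have xy : B x y = 1.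
  rewrite yE xy0 big1 ?subr0 // => i _; rewrite big1 // => s _.
  by rewrite xb ?mulr0.
have by' i s : (i < j)%N -> B (b i s) y = 0.
  move=> ij; rewrite yE (bigD1 (Ordinal ij)) //= [X in _ - (_ + X)]big1 ?addr0.
    rewrite (bigD1 s) //= big1 ?addr0.
      by rewrite hb // !eqxx /= mulrAC -expr2 sqrr_sign mul1r subrr.
    move=> s' s's; rewrite hb // eqxx /= (inj_eq negb_inj) (negPf s's).
    by rewrite mulr0.
  move=> i' i'i; rewrite big1 // => s' _; rewrite hb //.
  by rewrite eq_sym -[i]/(nat_of_ord (Ordinal ij)) val_eqE (negPf i'i) mulr0.
exists (fun i s => if (i < j)%N then b i s else if s then y else x).
split; last by rewrite ltnn.
  move=> i i' s s' /[!ltnS] ij i'j.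
  have [lij|] := ltnP i j.
    have [li'j|gi'] := ltnP i' j; first exact: hb.
    rewrite [i == i']ltn_eqF /=; last exact: leq_trans lij gi'.
    case: s' => //; first exact: by'.
    by rewrite gram_formC xb ?oppr0.
  move=> gij; have -> : i = j by apply/eqP; rewrite eqn_leq ij gij.
  have [li'j|gi'] := ltnP i' j.
    rewrite [j == i']gtn_eqF //=; case: s => //; last exact: xb.
    by rewrite gram_formC by' ?oppr0.
  have -> : i' = j by apply/eqP; rewrite eqn_leq i'j gi'.
  rewrite eqxx; case: s; case: s' => //=; rewrite ?G_alt //.
  by rewrite gram_formC xy expr1.
by move=> i ->.
Qed.

(** These are [2 j] linear equations in [m] unknowns. *)
Lemma hyperbolic_orthogonal j (b : nat -> bool -> 'rV[K]_m) : (j.*2 < m)%N ->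
  exists2 x, x != 0 & forall i s, (i < j)%N -> B x (b i s) = 0.
Proof.
move=> jm; pose M s := \matrix_(p < m, i < j) (G *m (b i s)^T) p 0.
have : kermx (row_mx (M false) (M true)) != 0.
  rewrite kermx_eq0; apply/negP => /eqP e.
  have := rank_leq_col (row_mx (M false) (M true)).
  by rewrite e addnn leqNgt jm.
move=> /rowV0Pn[x /sub_kermxP]; rewrite mul_mx_row -row_mx0.
move=> /eq_row_mx[x0 x1] xn0; exists x => // i s ij.
have /rowP/(_ (Ordinal ij)) : x *m M s = 0 by case: s.
rewrite [RHS]mxE /= => <-; rewrite /gram_form -mulmxA !mxE.
by apply: eq_bigr => p _; rewrite [RHS]mulrC mulrC; congr (_ * _); rewrite /M mxE.
Qed.

End AlternatingForm.

(** * Symplectic frames and their construction from hyperbolic pairs *)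

Section Frames.
Variables (K : fieldType) (n : nat) (G : 'M[K]_(2 * n)).
Hypothesis G_unit : G \in unitmx.
Hypothesis G_alt : forall x, gram_form G x x = 0.
Implicit Types (x y z : 'rV[K]_(2 * n)).

Section FrameTheory.
Variable L : frame n G.

Lemma frame_dual k x : x \in L k -> x != 0 ->
  exists2 t, t \in L (sneg k) & gram_form G x t != 0.
Proof.
move=> xk xn0; apply: contrapT => nt.
have Lk : L k = <[x]>%VS.
  apply/esym/eqP; rewrite eqEdim -memvE xk /=.
  by rewrite frame_dim dim_vline xn0.
suff /frame_isotropic : isotropic G (L k + L (sneg k)) by [].
have Lx t : t \in L (sneg k) -> gram_form G x t = 0.
  by move=> tk; apply: contrapT => /eqP xt; apply: nt; exists t.
have [t tk Lnk] : exists2 t, t \in L (sneg k) & L (sneg k) = <[t]>%VS.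
  have tk := memv_pick (L (sneg k)); exists (vpick (L (sneg k))) => //.
  apply/esym/eqP; rewrite eqEdim -memvE tk /= frame_dim dim_vline.
  by rewrite vpick0 -dimv_eq0 frame_dim.
by rewrite Lk Lnk; apply: isotropic_lines => //; exact: Lx.
Qed.

(** Lines of a frame are independent: a vector [t] of the line opposite to [L j] pairs nontrivially
    with [y j] and to 0 with all other lines. *)
Lemma frame_decomposition (S : pred (signed_index n))
    (y : signed_index n -> 'rV[K]_(2 * n)) j :
  (forall k, y k \in L k) -> \sum_k y k \in (\sum_(k | S k) L k)%VS ->
  ~~ S j -> y j = 0.
Proof.
move=> yL /memv_sumP[a aL ya] Sj; apply: contrapT => /eqP yj.
have [t tj] := frame_dual (yL j) yj; move/eqP; apply.
have ortho k x : k != j -> x \in L k -> gram_form G x t = 0.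
  move=> kj xk; apply: frame_ortho xk tj.
  by move=> /(inv_inj (@snegK n)) e; rewrite e eqxx in kj.
have : gram_form G (\sum_k y k) t = 0.
  rewrite ya gram_form_suml big1 // => k Sk; apply: ortho (aL _ Sk).
  by apply: contraNneq Sj => <-.
rewrite gram_form_suml (bigD1 j) //= [X in _ + X]big1 ?addr0 // => k kj.
exact: ortho (yL k).
Qed.

Lemma frame_line_sub (S : pred (signed_index n)) k :
  (L k <= \sum_(l | S l) L l)%VS -> S k.
Proof.
move=> LkS; apply: contrapT => /negP Sk.
have xn0 : vpick (L k) != 0 by rewrite vpick0 -dimv_eq0 frame_dim.
pose y l := if l == k then vpick (L k) else 0.
have := @frame_decomposition S y k _ _ Sk; rewrite /y eqxx => h.
move/eqP: xn0; apply; apply: h => [l|].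
  by case: eqP => [->|_]; rewrite ?mem0v ?memv_pick.
rewrite (bigD1 k) //= eqxx [X in _ + X]big1 ?addr0.
  exact: (subvP LkS) (memv_pick _).
by move=> l /negPf ->.
Qed.

End FrameTheory.

Lemma hyperbolic_complete j b : (j <= n)%N -> hyperbolic G j b ->
  exists2 b', hyperbolic G n b' & forall i, (i < j)%N -> b' i = b i.
Proof.
move=> jn; have [d] := ubnP (n - j)%N; elim: d j b jn => // d IH j b jn dj hb.
have [jn'|nj] := ltnP j n; last first.
  by exists b => // i i' s s' ni ni'; apply: hb; exact: leq_trans nj.
have [|x xn0 xb] := @hyperbolic_orthogonal _ _ G j b; first by lia.
have [b' [hb' b'b _]] := hyperbolic_extend G_unit G_alt hb xn0 xb.
have [||//|b'' hb'' b''b'] := IH j.+1 b'; [by lia|by lia|].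
by exists b'' => // i ij; rewrite b''b' ?b'b // ltnW.
Qed.

Lemma hyperbolic_frame b : hyperbolic G n b ->
  exists L : frame n G, forall k, L k = <[b k.1 k.2]>%VS.
Proof.
move=> hb; pose l (k : signed_index n) := <[b k.1 k.2]>%VS.
have bE (k k' : signed_index n) : gram_form G (b k.1 k.2) (b k'.1 k'.2) =
    if k' == sneg k then (-1) ^+ k.2 else 0.
  by rewrite hb // [k']surjective_pairing xpair_eqE [k'.1 == _]eq_sym.
have ld k : \dim (l k) = 1%N.
  rewrite dim_vline; case: eqP => // b0; have := bE k (sneg k).
  rewrite eqxx b0 -(scale0r 0) gram_formZl mul0r => /esym/eqP.
  by rewrite signr_eq0.
have li k k' : isotropic G (l k + l k') <-> k' <> sneg k.
  split=> [iso e|/eqP kk'].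
    have := iso (b k.1 k.2) (b k'.1 k'.2).
    rewrite bE e eqxx => /(_ _ _)/eqP; rewrite signr_eq0 => h; suff: false by [].
    by apply: h; [apply: (subvP (addvSl _ _))|apply: (subvP (addvSr _ _))];
      rewrite memv_line.
  by apply: isotropic_lines => //; rewrite bE (negPf kk').
by exists (Frame ld li).
Qed.

(** For [n > 1], [x] and [y] start the first two hyperbolic pairs; for [n = 1], a multiple of [y] is
    the partner of [x]. In both cases [sgen i0 (i0, false)] is the index of the line of [y]. *)
Lemma exists_frame (i0 : 'I_n) x y : i0 = 0%N :> nat -> x != 0 ->
  y \notin <[x]>%VS -> ((1 < n)%N -> gram_form G x y = 0) ->
  exists L : frame n G, L (i0, false) = <[x]>%VS /\
    L (sgen i0 (i0, false)) = <[y]>%VS.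
Proof.
move=> i00 xn0 yx xy.
have [t xt] := gram_form_dual G_unit xn0.
rewrite /sgen; case: insubP => [j _ /= j1|n1].
  have n1 : (1 < n)%N by rewrite -[1%N]/(0.+1) -i00 -j1 ltn_ord.
  rewrite sswapE tpermL.
  set c := gram_form G y t.
  have [|t' yt'] := gram_form_dual G_unit (x := y - c *: x).
    rewrite subr_eq0; apply: contraNneq yx => ->; exact/memvZ/memv_line.
  (* [t] pairs to 1 with [x] and to [c] with [y]. As [t'] pairs to 1 with [y - c *: x], this
     combination still pairs to 1 with [x] but to 0 with [y]. *)
  pose z := (1 + c * gram_form G x t') *: t - c *: t'.
  have xz : gram_form G x z = 1.
    by rewrite /z -scaleNr gram_formDr !gram_formZr xt; ring.
  have yz : gram_form G y z = 0.
    have e : gram_form G y t' = 1 + c * gram_form G x t'.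
      by rewrite -yt' -scaleNr gram_formDl gram_formZl; ring.
    by rewrite /z -scaleNr gram_formDr !gram_formZr e -/c; ring.
  pose b (i : nat) (s : bool) := if s then z else x.
  have hb : hyperbolic G 1 b.
    move=> i i' s s' /[!ltnS] /[!leqn0] /eqP -> /eqP ->; rewrite eqxx /b.
    case: s; case: s' => //=; rewrite ?G_alt //.
    by rewrite gram_formC // xz expr1.
  have [||b' [hb' b'0 b'1]] := hyperbolic_extend G_unit G_alt hb (x := y).
  - by apply: contraNneq yx => ->; rewrite mem0v.
  - move=> i [] _ //=; by rewrite /b gram_formC // xy // oppr0.
  have [b'' hb'' b''b'] := hyperbolic_complete n1 hb'.
  have [L LE] := hyperbolic_frame hb''.
  exists L; rewrite !LE /= i00 j1 i00 !b''b' // b'1.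
  by rewrite b'0.
rewrite sflipE eqxx /=.
have n1' : n = 1%N by move: n1 (ltn_ord i0); rewrite i00; lia.
(* Otherwise [x] and [y] would span an isotropic plane in a space of dimension 2. *)
have xyn0 : gram_form G x y != 0.
  have small d : (2 <= d)%N -> ~ (2 * d <= 2 * n)%N by lia.
  apply/eqP => /(isotropic_lines G_alt)/(isotropic_dim G_unit); apply: small.
  rewrite ltnNge; apply/negP => d1; move/negP: yx; apply.
  suff -> : <[x]>%VS = (<[x]> + <[y]>)%VS.
    by apply: (subvP (addvSr _ _)); exact: memv_line.
  by apply/eqP; rewrite eqEdim addvSl dim_vline xn0.
pose b (i : nat) (s : bool) := if s then (gram_form G x y)^-1 *: y else x.
have hb : hyperbolic G n b.
  move=> i i' s s'; rewrite [X in (i < X)%N]n1' [X in (i' < X)%N]n1'.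
  rewrite !ltnS !leqn0 => /eqP -> /eqP ->; rewrite eqxx /b.
  case: s; case: s' => //=; rewrite ?G_alt //.
    by rewrite gram_formZl (gram_formC G_alt y) mulrN mulVf.
  by rewrite gram_formZr mulVf.
have [L LE] := hyperbolic_frame hb; exists L; rewrite !LE /b /=; split=> //.
apply/eqP; rewrite eqEdim -memvE; apply/andP; split.
  exact/memvZ/memv_line.
by rewrite !dim_vline scaler_eq0 invr_eq0 (negPf xyn0).
Qed.

End Frames.

(** * Lines and planes in a lattice *)

Section FractionLattice.
Variables (R : idomainType) (m : nat).
Implicit Types (x y u v : 'rV[R]_m) (a b c d : R) (V : {vspace 'rV[{fraction R}]_m}).

Lemma to_fracD x y : to_frac (x + y) = to_frac x + to_frac y.
Proof. exact: map_mxD. Qed.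

Lemma to_fracZ a x : to_frac (a *: x) = tofrac a *: to_frac x.
Proof. exact: map_mxZ. Qed.

Lemma to_frac0 : to_frac (0 : 'rV[R]_m) = 0.
Proof. exact: map_mx0. Qed.

Lemma to_frac_inj : injective (@to_frac R m).
Proof.
move=> x y /rowP e; apply/rowP => i; apply/eqP; rewrite -tofrac_eq.
by have := e i; rewrite !mxE => ->.
Qed.

Lemma fraction_clear (x : {fraction R}) :
  exists2 d, d != 0 & exists a, tofrac d * x = tofrac a.
Proof.
elim/quotW: x => r; exists r.2; first exact: denom_ratioP.
exists r.1; unlock tofrac; rewrite -[LHS]FracField.pi_mul.
apply/eqP; rewrite FracField.equivf_def /FracField.mulf.
rewrite !numden_Ratio ?mul1r ?oner_eq0 ?denom_ratioP //; apply/eqP.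
by rewrite mulr1.
Qed.

Lemma clear_denominators (x : 'rV[{fraction R}]_m) :
  exists2 d, d != 0 & exists y, tofrac d *: x = to_frac y.
Proof.
have /choice[d dP] i : exists d, d != 0 /\ exists a, tofrac d * x 0 i = tofrac a.
  by have [d] := fraction_clear (x 0 i); exists d.
exists (\prod_i d i); first by apply/prodf_neq0 => i _; have [] := dP i.
have /choice[a aP] i : exists a, tofrac (\prod_j d j) * x 0 i = tofrac a.
  have [_ [a e]] := dP i; exists ((\prod_(j | j != i) d j) * a).
  by rewrite (bigD1 i) //= mulrC rmorphM mulrA [x 0 i * _]mulrC e -rmorphM mulrC.
by exists (\row_i a i); apply/rowP => i; rewrite !mxE aP.
Qed.

Lemma mem_frac_plane x u v :
  to_frac x \in (<[to_frac u]> + <[to_frac v]>)%VS <->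
  exists2 d, d != 0 & exists a b, d *: x = a *: u + b *: v.
Proof.
split=> [/memv_addP[_ /vlineP[s ->] [_ /vlineP[t ->] e]]|[d dn0 [a [b e]]]].
  have [d dn0 [a ea]] := fraction_clear s.
  have [d' d'n0 [b eb]] := fraction_clear t.
  exists (d * d'); first by rewrite mulf_neq0.
  exists (d' * a), (d * b); apply: to_frac_inj.
  rewrite to_fracD !to_fracZ !tofracM -ea -eb e scalerDr !scalerA.
  by congr (_ *: _ + _ *: _); ring.
have -> : to_frac x = (tofrac d)^-1 *: to_frac (a *: u + b *: v).
  by rewrite -e to_fracZ scalerA mulVf ?scale1r // tofrac_eq0.
by rewrite memvZ // to_fracD !to_fracZ memv_add // memvZ // memv_line.
Qed.

Lemma mem_frac_line x u : to_frac x \in <[to_frac u]>%VS <->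
  exists2 d, d != 0 & exists a, d *: x = a *: u.
Proof.
(* A line is treated as a plane whose second spanning vector is 0. *)
have -> : <[to_frac u]>%VS = (<[to_frac u]> + <[to_frac (0 : 'rV[R]_m)]>)%VS.
  apply/esym/addv_idPl; rewrite -memvE to_frac0; exact: mem0v.
rewrite mem_frac_plane; split=> -[d dn0 [a]].
  by move=> [b]; rewrite scaler0 addr0; exists d => //; exists a.
by exists d => //; exists a, 0; rewrite scaler0 addr0.
Qed.

Lemma line_integral_vector V : V != 0%VS -> exists2 x, x != 0 & to_frac x \in V.
Proof.
rewrite -vpick0 => vn0; have [d dn0 [x e]] := clear_denominators (vpick V).
exists x; last by rewrite -e memvZ // memv_pick.
apply: contraNneq vn0 => x0; move: e; rewrite x0 to_frac0 => /eqP.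
by rewrite scaler_eq0 tofrac_eq0 (negPf dn0).
Qed.

(** [u], [v] form an [R]-basis of the lattice points of the plane that they span. *)
Definition saturated_pair u v : Prop :=
  (forall a b, a *: u + b *: v = 0 -> a = 0 /\ b = 0) /\
  (forall x, to_frac x \in (<[to_frac u]> + <[to_frac v]>)%VS ->
     exists a b, x = a *: u + b *: v).

(** The coefficient of [u] is the [i]-th coordinate; that of [v] is the value of the functional [c]
    with its [i]-th term dropped. Both are in [R] for a lattice point. *)
Lemma saturated_pairP u v (c : 'I_m -> R) i :
  u = delta_mx 0 i -> v 0 i = 0 -> \sum_j c j * v 0 j = 1 -> saturated_pair u v.
Proof.
move=> -> vi cv; have cE b : b = \sum_j c j * (b * v 0 j).
  by rewrite -[LHS]mulr1 -cv mulr_sumr; apply: eq_bigr => j _; ring.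
have comp (a b : R) : (a *: delta_mx 0 i + b *: v) 0 i = a.
  by rewrite !mxE !eqxx vi mulr0 addr0 mulr1.
have comp' (a b : R) j : j != i ->
    (a *: delta_mx 0 i + b *: v) 0 j = b * v 0 j.
  by move=> /negPf ji; rewrite !mxE eqxx ji mulr0 add0r.
split.
  move=> a b e; have a0 : a = 0 by rewrite -(comp a b) e mxE.
  split=> //; rewrite (cE b) big1 // => j _.
  have [->|ji] := eqVneq j i; first by rewrite vi !mulr0.
  by rewrite -(comp' a b) // e mxE mulr0.
move=> x /mem_frac_plane[d dn0 [a [b e]]].
have ea : a = d * x 0 i by rewrite -(comp a b) -e mxE.
have eb : b = d * \sum_(j | j != i) c j * x 0 j.
  rewrite [LHS]cE (bigD1 i) //= vi !mulr0 add0r mulr_sumr.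
  apply: eq_bigr => j ji; rewrite -(comp' a b) // -e mxE; ring.
exists (x 0 i), (\sum_(j | j != i) c j * x 0 j).
apply/rowP => j; apply: (mulfI dn0).
have /rowP/(_ j) : d *: x = d *: (x 0 i *: delta_mx 0 i +
    (\sum_(j | j != i) c j * x 0 j) *: v) by rewrite e {1}ea {1}eb scalerDr !scalerA.
by rewrite [LHS]mxE [RHS]mxE.
Qed.

(** Stated as cyclicity: the lattice is torsion-free, so for a line this means free of rank 1. *)
Definition free_lattice V : Prop := exists2 y, to_frac y \in V &
  forall x, to_frac x \in V -> exists c, x = c *: y.

Lemma free_lattice_line u v : saturated_pair u v ->
  free_lattice <[to_frac u]>.
Proof.
move=> [indep sat]; exists u; first exact: memv_line.
move=> x xu; have [|a [b e]] := sat x; first exact: (subvP (addvSl _ _)).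
have /mem_frac_line[d dn0 [c e']] := xu.
have [|_ /eqP] := indep (d * a - c) (d * b).
  by rewrite scalerBl addrAC -!scalerA -scalerDr -e e' subrr.
by rewrite mulf_eq0 (negPf dn0) => /eqP b0; exists a; rewrite e b0 scale0r addr0.
Qed.

(** Coordinates with respect to [u], [v] carry the lattice of this line to the module of
    [cyclic_line a b]. *)
Lemma free_lattice_cyclic u v a b : saturated_pair u v -> b != 0 ->
  free_lattice <[to_frac (a *: u + b *: v)]> -> cyclic_line a b.
Proof.
move=> [indep sat] bn0 [y yL yP].
have inj s t s' t' : s *: u + t *: v = s' *: u + t' *: v -> s = s' /\ t = t'.
  move=> e; have [|/eqP+ /eqP] := indep (s - s') (t - t').
    rewrite !scalerBl addrACA e -opprD subrr //.
  by rewrite !subr_eq0 => /eqP -> /eqP ->.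
have [|c [d e]] := sat y.
  apply: (subvP _ _ yL); rewrite -memvE; apply/mem_frac_plane.
  by exists 1; [exact: oner_neq0|exists a, b; rewrite scale1r].
exists c, d; split.
  have /mem_frac_line[z zn0 [k]] := yL.
  rewrite e !scalerDr !scalerA => /inj[ec ed]; apply: (mulfI zn0).
  by rewrite !mulrA ec ed; ring.
move=> s t st; have [|f] := yP (s *: u + t *: v).
  apply/mem_frac_line; exists b => //; exists t.
  by rewrite !scalerDr !scalerA [b * s]mulrC st [t * b]mulrC.
by rewrite e scalerDr !scalerA => /inj[-> ->]; exists f.
Qed.

(* In a basis of [R^2], a functional splitting off the vector [(a, b)] has
   coordinates [(p, q)] with [a p + b q = 1], and its kernel is generated by
   [(-q, p)]. *)
Lemma free_lattice_complement u v (V W : {vspace 'rV[{fraction R}]_m}) :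
  (forall x, to_frac x \in V -> exists a b, x = a *: u + b *: v) ->
  (forall x, to_frac x \in W -> exists a b, x = a *: u + b *: v) ->
  (forall x, x = u \/ x = v -> exists y z,
     [/\ to_frac y \in V, to_frac z \in W & x = y + z]) ->
  (forall x, to_frac x \in V -> to_frac x \in W -> x = 0) ->
  V != 0%VS -> free_lattice V -> free_lattice W.
Proof.
move=> Vuv Wuv dec disj Vn0 [y yV yP].
have yn0 : y != 0.
  have [x xn0 /yP[c xy]] := line_integral_vector Vn0.
  by apply: contraNneq xn0 => y0; rewrite xy y0 scaler0.
have [a [b yE]] := Vuv _ yV.
(* [p] and [q] are the [y]-coordinates of [u] and [v] along [W]. *)
have [|yu [u' [/yP[p ->] u'W uE]]] := dec u; first by left.
have [|yv [v' [/yP[q ->] v'W vE]]] := dec v; first by right.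
have comb s t : s *: u + t *: v = (s * p + t * q) *: y + (s *: u' + t *: v').
  rewrite [in LHS]uE [in LHS]vE !scalerDr !scalerA addrACA -scalerDl //.
have W' s t : to_frac (s *: u' + t *: v') \in W.
  by rewrite to_fracD !to_fracZ memvD // memvZ.
have split0 s z : to_frac z \in W -> s *: y + z = 0 -> s = 0.
  move=> zW e; have zE : z = - s *: y.
    by apply/eqP; rewrite scaleNr -addr_eq0 addrC e.
  have : z = 0 by apply: disj => //; rewrite zE to_fracZ memvZ.
  have /rV0Pn[i yi] := yn0.
  rewrite zE => /rowP/(_ i); rewrite !mxE => /eqP.
  by rewrite mulf_eq0 (negPf yi) orbF oppr_eq0 => /eqP.
have ab1 : a * p + b * q = 1.
  apply/eqP; rewrite -subr_eq0; apply/eqP.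
  apply: (split0 _ (a *: u' + b *: v')) => //.
  by rewrite scalerBl scale1r addrAC -comb -yE subrr.
exists (- q *: u + p *: v).
  rewrite comb; have -> : - q * p + p * q = 0 by ring.
  by rewrite scale0r add0r.
move=> x xW; have [c [d xE]] := Wuv _ xW.
have cd0 : c * p + d * q = 0.
  apply: (split0 _ (c *: u' + d *: v' - x)).
    rewrite to_fracD -scaleN1r to_fracZ memvD // memvZ //.
  by rewrite addrA -comb -xE subrr.
(* The determinant of [(a, b)] and [(c, d)]; the claim follows from [a * p + b * q = 1] and
   [c * p + d * q = 0]. *)
exists (a * d - b * c); rewrite xE scalerDr !scalerA.
congr (_ *: _ + _ *: _).
  have -> : (a * d - b * c) * - q = c * (a * p + b * q) - a * (c * p + d * q).
    by ring.
  by rewrite ab1 cd0; ring.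
have -> : (a * d - b * c) * p = d * (a * p + b * q) - b * (c * p + d * q).
  by ring.
by rewrite ab1 cd0; ring.
Qed.

End FractionLattice.

(** * Symplectic forms and integral frames on the lattice *)

Section SymplecticLattice.
Variables (R : idomainType) (n : nat) (w : {biscalar 'rV[R]_(2 * n)}).
Hypothesis w_symplectic : symplectic_form w.

Lemma gram_alternating x : gram_form (gram w) x x = 0.
Proof.
have [d dn0 [y e]] := clear_denominators x.
have := gram_formE w y y; rewrite w_symplectic.1 -e gram_formZl gram_formZr.
rewrite rmorph0 => /eqP; rewrite !mulf_eq0 tofrac_eq0 (negPf dn0) /=.
by move/eqP.
Qed.

Lemma gram_unit : gram w \in unitmx.
Proof.
rewrite -row_free_unit; apply: inj_row_free => x xG.
have [d dn0 [y e]] := clear_denominators x.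
have y0 : y = 0.
  apply: w_symplectic.2 => z; apply/eqP; rewrite -tofrac_eq0 -gram_formE.
  by rewrite -e /gram_form -scalemxAl xG scaler0 mul0mx mxE.
move: e; rewrite y0 to_frac0 => /eqP; rewrite scaler_eq0 tofrac_eq0 (negPf dn0).
by move/eqP.
Qed.

(** For [n > 1], [u] is the first standard vector and [v] a unimodular combination of the next three
    that is orthogonal to [u]. For [n = 1] the standard basis serves. *)
Lemma exists_isotropic_pair : dedekind_domain R -> (0 < n)%N ->
  exists u v, saturated_pair u v /\ ((1 < n)%N -> w u v = 0).
Proof.
move=> dR n0; have [n1|n1] := leqP n 1.
  have i0 : (0 < 2 * n)%N by lia.
  have i1 : (1 < 2 * n)%N by lia.
  exists (delta_mx 0 (Ordinal i0)), (delta_mx 0 (Ordinal i1)); split; last by lia.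
  apply: (@saturated_pairP _ _ _ _ (fun j => (j == Ordinal i1)%:R) (Ordinal i0)) => //.
    by rewrite mxE.
  rewrite (bigD1 (Ordinal i1)) //= big1 ?addr0; first by rewrite mxE !eqxx mul1r.
  by move=> j /negPf ->; rewrite mul0r.
have i0 : (0 < 2 * n)%N by lia.
have i1 : (1 < 2 * n)%N by lia.
have i2 : (2 < 2 * n)%N by lia.
have i3 : (3 < 2 * n)%N by lia.
pose e i : 'rV[R]_(2 * n) := delta_mx 0 i.
pose u := e (Ordinal i0).
have [x [y [z [orth [a [b [c abc]]]]]]] := orthogonal_unimodular dR
  (w u (e (Ordinal i1))) (w u (e (Ordinal i2))) (w u (e (Ordinal i3))).
exists u, (x *: e (Ordinal i1) + y *: e (Ordinal i2) + z *: e (Ordinal i3)).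
split; last by move=> _; rewrite !linearDr !linearZr_LR -[RHS]orth.
pose f (j : 'I_(2 * n)) := a * (j == Ordinal i1)%:R + b * (j == Ordinal i2)%:R
                          + c * (j == Ordinal i3)%:R.
apply: (@saturated_pairP _ _ _ _ f (Ordinal i0)) => //.
  by rewrite !mxE !eqxx /= !mulr0 !addr0.
rewrite (bigD1 (Ordinal i1)) // (bigD1 (Ordinal i2)) // (bigD1 (Ordinal i3)) //=.
rewrite big1; last first.
  move=> j /andP[/andP[/negPf j1 /negPf j2] /negPf j3].
  by rewrite /f j1 j2 j3 !mulr0 !addr0 mul0r.
by rewrite -[RHS]abc /f !mxE !eqxx /= !(mulr0, mulr1, addr0, add0r) !addrA.
Qed.

(** The integral decomposition of a lattice point of the plane has components only in [L k] and
    [L l], so the free lattice of the plane is the direct sum of those of the two lines. *)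
Lemma integral_frame_swap (L : frame n (gram w)) k l u v : integral_frame L ->
  saturated_pair u v -> k <> l ->
  (L k + L l = <[to_frac u]> + <[to_frac v]>)%VS ->
  free_lattice (L k) -> free_lattice (L l).
Proof.
move=> intL [_ sat] kl LW.
have Lkl : (L k + L l = \sum_(j | (j == k) || (j == l)) L j)%VS.
  rewrite (bigD1 k) ?eqxx //= (bigD1 l) /=; last first.
    by rewrite eqxx orbT; apply/eqP => /esym.
  rewrite big1 ?addv0 // => j; by case: (j == k); case: (j == l).
apply: (@free_lattice_complement _ _ u v).
- by move=> x xk; apply: sat; rewrite -LW; apply: (subvP (addvSl _ _)).
- by move=> x xl; apply: sat; rewrite -LW; apply: (subvP (addvSr _ _)).
- move=> x xuv; have xW : to_frac x \in (L k + L l)%VS.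
    rewrite LW; case: xuv => ->.
      by apply: (subvP (addvSl _ _)); exact: memv_line.
    by apply: (subvP (addvSr _ _)); exact: memv_line.
  have [y [[yL xE] _]] := intL x; exists (y k), (y l); split=> //.
  have y0 j : ~~ ((j == k) || (j == l)) -> y j = 0.
    move=> jkl; apply: to_frac_inj; rewrite to_frac0.
    apply: (frame_decomposition gram_alternating (L := L)
      (S := fun j => (j == k) || (j == l)) (y := fun j => to_frac (y j))) => //.
    have <- : to_frac x = \sum_j to_frac (y j).
      rewrite xE /to_frac; exact: (raddf_sum (map_mx (@tofrac R))).
    by rewrite -Lkl.
  rewrite xE (bigD1 k) //= (bigD1 l) /=; last by apply/eqP => /esym.
  rewrite big1 ?addr0 // => j /andP[jk jl]; apply: y0.
  by rewrite negb_or jk jl.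
- move=> x xk xl; apply: to_frac_inj; rewrite to_frac0.
  pose y j := if j == k then to_frac x else 0.
  have := @frame_decomposition _ _ _ gram_alternating L (pred1 l) y k.
  rewrite /y eqxx; apply; last by apply/eqP.
    by move=> j; case: eqP => [->|_] //; exact: mem0v.
  rewrite big_pred1_eq (bigD1 k) //= eqxx big1 ?addr0 // => j /negPf -> //.
- by rewrite -dimv_eq0 frame_dim.
Qed.

End SymplecticLattice.

(** * The functional *)

Lemma sgen_neq n (i : 'I_n) : sgen i (i, false) <> (i, false).
Proof.
rewrite /sgen; case: insubP => [j _ /= ji|_]; last by rewrite sflipE eqxx.
by rewrite sswapE tpermL => -[e]; move: ji; rewrite e; lia.
Qed.

(** * Simplices of isotropic subspaces and flags of a frame *)

Section Flags.
Variables (K : fieldType) (n : nat) (G : 'M[K]_(2 * n)).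

Lemma sorted_isotropic_dim (s : seq (isotropic_poset G)) x0 i :
  sorted <%O s -> (i < size s)%N -> (i < \dim (val (nth x0 s i)))%N.
Proof.
move=> ss; elim: i => [|i IH] si.
  by rewrite lt0n dimv_eq0; case: (nth x0 s 0) => V /= /andP[].
apply: leq_ltn_trans (IH (ltnW si)) _; have : (nth x0 s i < nth x0 s i.+1)%O.
  by rewrite (sorted_ltn_nth lt_trans) ?inE // ltnW.
rewrite lt_neqAle => /andP[ne le]; rewrite ltnNge; apply: contra ne => d.
by apply/eqP/val_inj/eqP; rewrite eqEdim d andbT; exact: le.
Qed.

Lemma no_large_simplex : G \in unitmx -> simplex (isotropic_poset G) n.+1 -> False.
Proof.
move=> Gu [s /andP[ss /eqP sz]].
have [x0 _] : exists2 x0, x0 \in s & True.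
  by case: s {ss} sz => // x s _; exists x; rewrite ?mem_head.
have := @sorted_isotropic_dim s x0 n ss; rewrite sz => /(_ (leqnn _)) d.
case: (nth x0 s n) d => V /= /andP[_ /asboolP/(isotropic_dim Gu)].
by move: (\dim V) => e; lia.
Qed.

(** No simplex has [n + 1] vertices, so the only boundary in top degree is 0, and relations between
    classes hold already between chains. *)
Lemma apartment_relation (I : finType) (c : I -> int) (L : I -> frame n G)
    (L0 : frame n G) : G \in unitmx ->
  apartment_class L0 = \sum_i apartment_class (L i) *~ c i ->
  apartment_chain L0 = \sum_i apartment_chain (L i) *~ c i.
Proof.
move=> Gu e.
pose z := \sum_i Cycle (apartment_is_cycle (L i)) *~ c i.
have : (Cycle (apartment_is_cycle L0) - z)
    \in is_boundary (P := isotropic_poset G) (p := n).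
  rewrite Quotient.idealrBE; apply/eqP.
  rewrite -[LHS]/(apartment_class L0) e /z raddf_sum.
  by apply: eq_bigr => i _; rewrite raddfMz.
case/asboolP => b; have -> : b = 0.
  by apply/eqP/freeg_eqP => s; case: (no_large_simplex Gu s).
rewrite raddf0 raddfB /= => /esym/eqP; rewrite subr_eq0 => /eqP ->.
by rewrite -[LHS]/(val z) /z raddf_sum; apply: eq_bigr => i _; rewrite raddfMz.
Qed.

Section FrameSimplex.
Variable L : frame n G.

Lemma nth_frame_simplex s x0 (j : 'I_n) :
  val (nth x0 (val (frame_simplex L s)) j) = frame_flag L (val s) j.+1.
Proof. by rewrite /= (nth_map j) ?size_enum_ord // nth_ord_enum. Qed.

Lemma frame_flag1 (s : {perm signed_index n}) (i0 : 'I_n) : i0 = 0%N :> nat ->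
  frame_flag L s 1 = L (s (i0, false)).
Proof.
move=> i00; rewrite /frame_flag (big_pred1 i0) // => i.
by rewrite /= ltnS leqn0 -val_eqE /= i00.
Qed.

(** For [n > 1], [sgen i0] exchanges the first two indices, so the second summand is the line of [s]
    at the second index. *)
Lemma frame_flag_plane (s : {perm signed_index n}) (i0 : 'I_n) :
  i0 = 0%N :> nat -> (1 < n)%N ->
  frame_flag L s 2 = (L (s (i0, false)) + L ((sgen i0 * s)%g (i0, false)))%VS.
Proof.
move=> i00 n1; rewrite permM /sgen; case: insubP => [j _ /= j1|]; last first.
  by rewrite i00 n1.
rewrite sswapE tpermL /frame_flag (bigD1 i0) ?i00 //= (bigD1 j) /=.
  rewrite big1 ?addv0 // => i; rewrite -!val_eqE /= j1 i00; lia.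
by rewrite -val_eqE /= j1 i00.
Qed.

(** Replaces [frame_flag_plane] for [n = 1], where flags have no plane: two distinct lines span a
    space of dimension 2. *)
Lemma frame_plane_full (s : {perm signed_index n}) (i0 : 'I_n) :
  (forall x, gram_form G x x = 0) -> n = 1%N ->
  (L (s (i0, false)) + L ((sgen i0 * s)%g (i0, false)))%VS = fullv.
Proof.
move=> Galt n1; set k := s _; set l := _ (i0, false).
have kl : k <> l.
  by rewrite /l permM => /perm_inj/esym/sgen_neq.
apply/eqP; rewrite eqEdim subvf dimvf /=.
suff : (1 < \dim (L k + L l))%N by rewrite /dim /= ; lia.
rewrite ltnNge; apply/negP => d; apply: kl; apply/eqP.
rewrite eq_sym; apply: (@frame_line_sub _ _ _ Galt L (pred1 k)).
rewrite big_pred1_eq; suff -> : L k = (L k + L l)%VS by exact: addvSr.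
by apply/eqP; rewrite eqEdim addvSl frame_dim.
Qed.

End FrameSimplex.

End Flags.

(** * Counting flags whose first line has a free lattice *)

Section Functional.
Variables (R : idomainType) (n : nat) (w : {biscalar 'rV[R]_(2 * n)}).
Hypothesis w_symplectic : symplectic_form w.
Variables (L0 : frame n (gram w)) (i0 : 'I_n) (u v : 'rV[R]_(2 * n)).
Hypothesis i00 : i0 = 0%N :> nat.
Hypothesis uv_sat : saturated_pair u v.
Let k0 : signed_index n := (i0, false).
Let l0 : signed_index n := sgen i0 k0.
Hypothesis L0_plane : (L0 k0 + L0 l0 = <[to_frac u]> + <[to_frac v]>)%VS.
Hypothesis L0_free : free_lattice (L0 k0).
Hypothesis L0_nonfree : ~ free_lattice (L0 l0).

Let Galt := gram_alternating w_symplectic.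

Lemma is_signed1 : is_signed (1%g : {perm signed_index n}).
Proof. by apply/signedP => k; rewrite !perm1. Qed.

Definition spid : signed_perm n := exist _ 1%g is_signed1.

(** The fixed flag [W_2 < ... < W_n] is that of the identity simplex of [L0];
    [frame_vertex L0 spid i0] is the default of [nth], on lists of length [n]. *)
Definition flag_test (s : simplex (isotropic_poset (gram w)) n) : Prop :=
  free_lattice (val (nth (frame_vertex L0 spid i0) (val s) i0)) /\
  forall j : 'I_n, (0 < j)%N ->
    val (nth (frame_vertex L0 spid i0) (val s) j) = frame_flag L0 1%g j.+1.

Definition flag_functional : chain (isotropic_poset (gram w)) n -> int^o :=
  fglift (fun s => (`[< flag_test s >])%:R : int^o).

HB.instance Definition _ := GRing.isZmodMorphism.Build
  (chain (isotropic_poset (gram w)) n) int^o flag_functional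
  (lift_is_additive _).

Lemma flag_functionalE L : flag_functional (apartment_chain L) =
  \sum_s (-1) ^+ slength (val s) * (`[< flag_test (frame_simplex L s) >])%:R.
Proof.
rewrite /apartment_chain raddf_sum; apply: eq_bigr => s _ /=.
have -> : (-1) ^+ slength (val s) *: << frame_simplex L s >> =
    << (-1) ^+ slength (val s) *g frame_simplex L s >>
       :> {freeg (simplex (isotropic_poset (gram w)) n)}.
  by apply/eqP/freeg_eqP => x; rewrite coeffZ !coeffU mul1r.
by rewrite /flag_functional liftU.
Qed.

Lemma flag_testE L s : flag_test (frame_simplex L s) <->
  free_lattice (L (val s k0)) /\
  forall j : 'I_n, (0 < j)%N -> frame_flag L (val s) j.+1 = frame_flag L0 1%g j.+1.
Proof.
rewrite /flag_test nth_frame_simplex -(frame_flag1 L (val s) i00) i00.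
by split=> -[h1 h2]; split=> // j /h2; rewrite nth_frame_simplex.
Qed.

(** [sgen_mul i0] changes only the first vertex, replacing a line of the frame by the other one in
    the plane, whose lattice is free as well. *)
Lemma flag_test_swap L s : integral_frame L ->
  flag_test (frame_simplex L s) -> flag_test (frame_simplex L (sgen_mul i0 s)).
Proof.
move=> intL /flag_testE[free flags]; apply/flag_testE; split; last first.
  move=> j j0; rewrite -flags //=; apply: frame_flag_sgen.
  by rewrite -val_eqE /= i00 -lt0n.
apply: integral_frame_swap free => //; first exact: uv_sat.
  by rewrite /= permM => /perm_inj/esym/sgen_neq.
rewrite -L0_plane; have [n1|n1] := ltnP 1 n.
  rewrite -frame_flag_plane //.
  have /= -> := flags (Ordinal n1) isT.
  by rewrite (frame_flag_plane _ _ i00) // !permM perm1 perm1.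
have n1' : n = 1%N by move: (ltn_ord i0); lia.
rewrite frame_plane_full //.
by have := frame_plane_full L0 1%g i0 Galt n1'; rewrite mulg1 perm1 => ->.
Qed.

(** [sgen_mul i0] is an involution that reverses signs and preserves the test, so the sum equals its
    own negative. *)
Lemma flag_functional_integral L : integral_frame L ->
  flag_functional (apartment_chain L) = 0.
Proof.
move=> intL; rewrite flag_functionalE; set S := \sum_s _.
suff : S = - S by move: S; rewrite /GRing.regular => S; lia.
rewrite {1}/S (reindex_inj (can_inj (sgen_mulK i0))) /= /S -sumrN.
apply: eq_bigr => s _; rewrite -mulNr; congr (_ * _).
  rewrite -[LHS]signr_odd -[in RHS]signr_odd.
  rewrite (odd_slength_mul (mem_sgen i0) (valP s)).
  by case: (odd _); rewrite /= ?expr0 ?expr1 ?opprK.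
congr (nat_of_bool _)%:R; apply: asbool_equiv_eq; split; last exact: flag_test_swap.
by move/(flag_test_swap intL); rewrite sgen_mulK.
Qed.

(** Freeness singles out [k0] among the two indices [k0] and [l0] of the plane; each further step of
    the flag then adds a single new index, so [s] fixes them one by one. *)
Lemma flag_test_frame s : flag_test (frame_simplex L0 s) <-> s = spid.
Proof.
rewrite flag_testE; split=> [[free flags]|-> /=]; last by rewrite perm1.
have sub k (j : 'I_n) : (0 < j)%N -> (L0 k <= frame_flag L0 (val s) j.+1)%VS ->
    ~~ k.2 && (k.1 <= j)%N.
  move=> j0; rewrite flags // => kj.
  apply: (@frame_line_sub _ _ _ Galt L0 (fun l => ~~ l.2 && (l.1 <= j)%N)).
  apply: subv_trans kj _; apply/subv_sumP => i ij.
  by apply: (sumv_sup (i, false)) => //=; rewrite perm1.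
have s0 : val s k0 = k0.
  have nl : val s k0 <> l0 by move=> e; apply: L0_nonfree; rewrite -e.
  rewrite /l0 /sgen in nl; case: insubP nl => [j _ /= j1|n1].
    rewrite i00 in j1; rewrite sswapE tpermL => nl.
    have := sub (val s k0) j; rewrite j1 => /(_ isT) h.
    have /h {h} : (L0 (val s k0) <= frame_flag L0 (val s) 2)%VS.
      by apply: (sumv_sup i0) => //; rewrite i00.
    case: (val s k0) nl => i [] //= nl; case: (posnP i) => [i_0 _|ip i1].
      by congr (_, _); apply: val_inj; rewrite /= i_0 i00.
    by case: nl; congr (_, _); apply: val_inj; rewrite /= j1; lia.
  (* Here [n = 1], and [k0] and [l0] are the only indices. *)
  rewrite sflipE eqxx /=; case: (val s k0) => i [] nl.
    case: nl; congr (_, _); apply: val_inj => /=.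
    by move: (ltn_ord i) n1; rewrite i00; lia.
  congr (_, _); apply: val_inj => /=; move: (ltn_ord i) n1; rewrite i00; lia.
have sj (j : 'I_n) : val s (j, false) = (j, false).
  have [d] := ubnP j; elim: d j => // d IH j jd.
  have [j0|jp] := posnP j.
    by have -> : j = i0 by apply: val_inj; rewrite /= j0 i00.
  have := sub (val s (j, false)) j jp.
  have -> : (L0 (val s (j, false)) <= frame_flag L0 (val s) j.+1)%VS.
    exact: (sumv_sup j).
  move=> /(_ isT); case e : (val s (j, false)) => [i []] //= ij.
  congr (_, _); apply: contrapT => ne.
  have lij : (i < j)%N by rewrite ltn_neqAle ij andbT; apply/eqP => /val_inj.
  have /IH : (i < d)%N by lia.
  by move=> si; have /perm_inj[] := etrans si (esym e).
apply: val_inj; apply/permP => -[j []]; rewrite perm1 //.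
by have := signedE s (j, false); rewrite /sneg /= sj.
Qed.

Lemma flag_functional_frame : flag_functional (apartment_chain L0) != 0.
Proof.
rewrite flag_functionalE (bigD1 spid) //= big1 ?addr0.
  rewrite mulf_neq0 ?signr_eq0 //.
  by have /asboolP -> : flag_test (frame_simplex L0 spid) by apply/flag_test_frame.
move=> s /eqP ne; have -> : `[< flag_test (frame_simplex L0 s) >] = false.
  by apply/negbTE/asboolPn => /flag_test_frame.
by rewrite mulr0.
Qed.

End Functional.

Theorem theorem1p2 (R : idomainType) (h n : nat)
    (w : {biscalar 'rV[R]_(2 * n)})
    (R_dedekind : dedekind_domain R)
    (class_number_R : class_number R h) (h_ge2 : (2 <= h)%N)
    (n_ge1 : (1 <= n)%N)
    (w_symplectic : symplectic_form w) :
  ~ generated_by (@integral_apartment_class R n w).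
Proof.
have Galt := gram_alternating w_symplectic.
have Gu := gram_unit w_symplectic.
have [u [v [sat uv]]] := exists_isotropic_pair w R_dedekind n_ge1.
have [a [b [bn0 ncyc]]] := exists_noncyclic_line R_dedekind class_number_R h_ge2.
have [indep _] := sat.
(* The line of [u] has a free lattice; that of [v'] does not, by the choice of [(a, b)]. *)
pose i0 : 'I_n := Ordinal n_ge1; pose v' := a *: u + b *: v.
have [||||L0 [L0k L0l]] := @exists_frame _ _ _ Gu Galt i0 (to_frac u) (to_frac v').
- by [].
- rewrite -to_frac0 (inj_eq (@to_frac_inj _ _)); apply/eqP => u0.
  have [|/eqP] := indep 1 0; first by rewrite u0 scaler0 add0r scale0r.
  by rewrite oner_eq0.
- apply/negP => /mem_frac_line[d dn0 [c e]].
  have [|_ /eqP] := indep (d * a - c) (d * b).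
    by rewrite scalerBl addrAC -!scalerA -scalerDr e subrr.
  by rewrite mulf_eq0 (negPf dn0) (negPf bn0).
- move=> n1; rewrite gram_formE /v' linearDr !linearZr_LR /= uv // w_symplectic.1.
  by rewrite !mulr0 addr0 rmorph0.
have plane : (L0 (i0, false) + L0 (sgen i0 (i0, false)) =
    <[to_frac u]> + <[to_frac v]>)%VS.
  rewrite L0k L0l; apply/eqP; rewrite eqEsubv !subv_add !addvSl /= -!memvE.
  apply/andP; split; apply/mem_frac_plane.
    by exists 1; [exact: oner_neq0|exists a, b; rewrite scale1r].
  (* [b *: v = v' - a *: u] with [b] nonzero. *)
  by exists b => //; exists (- a), 1; rewrite scale1r scaleNr addKr.
have free0 : free_lattice (L0 (i0, false)).
  by rewrite L0k; exact: free_lattice_line sat.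
have nfree : ~ free_lattice (L0 (sgen i0 (i0, false))).
  by rewrite L0l => /(free_lattice_cyclic sat bn0).
move=> gen; have [k [c [g [gS gE]]]] := gen (apartment_class L0).
have /choice[L LP] i : exists L, integral_frame L /\ g i = apartment_class L.
  by have [L] := gS i; exists L.
have e : apartment_chain L0 = \sum_i apartment_chain (L i) *~ c i.
  apply: apartment_relation => //; rewrite gE; apply: eq_bigr => i _.
  by have [_ ->] := LP i.
(* The functional is nonzero on the chain of [L0] but zero on every chain of an integral [L i]. *)
have := flag_functional_frame w_symplectic (erefl : i0 = 0%N :> nat) free0 nfree.
rewrite e raddf_sum big1 ?eqxx // => i _; rewrite raddfMz /=.
have [intL _] := LP i.
by rewrite (flag_functional_integral w_symplectic _ sat plane) // mul0rz.
Qed.
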